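(* Let $0<q<1$, $0<a_1,b_1,a_2<1$, $b_2>0$, $\mathcal X=\mathbb Z_{\ge0}$, and define for $x,y\in\mathcal X$ $$K(x,y)=\sum_{z_2=0}^{\min(x,y)}\pi_{qH}(z_2,y,a_1,b_1)\sum_{z_1=\max(x,y)}^{\infty}\pi_{qH}(x-z_2,z_1-z_2,b_1,a_2)\,\pi'(z_1,y),$$ $$\pi'(z_1,y)=\frac{(-a_2^{-1}b_2;q)_y(a_2;q)_{z_1-y}(a_2^{-1}b_2)^{z_1-y}q^{\binom{z_1}2-\binom y2}}{(-b_2;q)_{z_1}(q;q)_{z_1-y}}\frac{(-b_2;q)_\infty}{(-a_2^{-1}b_2;q)_\infty}.$$ Then $K(x,y)\ge0$, $\sum_{x\in\mathcal X}K(x,y)=1$, and with $\pi(x)=\pi_{qM}(x,a_1b_1q^{-1},(a_1b_1a_2)^{-1}b_2)$, $\check P_n(x)=\check P_{qM,n}(x,a_1b_1q^{-1},(a_1b_1a_2)^{-1}b_2)$, for all $x,y,n\in\mathcal X$, $$K(x,y)\,\pi(y)=K(y,x)\,\pi(x),\qquad\sum_{y\in\mathcal X}K(x,y)\,\pi(y)\,\check P_n(y)=\kappa(n)\,\pi(x)\,\check P_n(x),$$ $$\kappa(n)=\sum_{k=0}^n\frac{(q^{-n};q)_k(b_1;q)_k(a_2;q)_k}{(a_1b_1;q)_k(b_1a_2;q)_k(q;q)_k}(a_1b_1q^n)^k.$$ Moreover, $v_n(x)=(-1)^x\frac{q^{\binom x2}}{(q;q)_x}\check P_{qM,n}(x,-a_2^{-1}b_2q^{-1},a_1b_1a_2b_2^{-1})$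 satisfies $\sum_{y\in\mathcal X}K(x,y)v_n(y)=\kappa^{(-)}(n)v_n(x)$ for all $n,x\in\mathcal X$, with $$\kappa^{(-)}(n)=\frac{(b_1;q)_\infty(-b_2;q)_\infty}{(b_1a_2;q)_\infty(-a_2^{-1}b_2;q)_\infty}\sum_{k=0}^n\frac{(q^{-n};q)_k(b_1;q)_k(a_2;q)_k}{(-b_2;q)_k(a_1b_1;q)_k}\frac{(-a_2^{-1}b_2q^n)^k}{(q;q)_k}\,S_k,$$ $$S_k=\sum_{j=0}^\infty\frac{(a_1;q)_j(a_2q^k;q)_j(-a_2^{-1}b_2q^k;q)_j}{(-b_2q^k;q)_j(a_1b_1q^k;q)_j(q;q)_j}\,b_1^{\,j}.$$
   Context: $(a;q)_n=\prod_{i=0}^{n-1}(1-aq^i)$, $(a;q)_\infty=\prod_{i\ge0}(1-aq^i)$. $q$-Hahn measure ($0<a<1$, $b<1$, integers $0\le z\le y$): $\pi_{qH}(z,y,a,b)=\frac{(q;q)_y}{(q;q)_z(q;q)_{y-z}}\frac{(a;q)_z(b;q)_{y-z}a^{y-z}}{(ab;q)_y}$. $q$-Meixner measure ($0<\beta<q^{-1}$, $\gamma>0$, $x\in\mathbb Z_{\ge0}$): $\pi_{qM}(x,\beta,\gamma)=\frac{(\beta q;q)_x}{(q;q)_x(-\beta\gamma q;q)_x}\gamma^xq^{\binom x2}\frac{(-\beta\gamma q;q)_\infty}{(-\gamma;q)_\infty}$. The functions $\check P_{qM,n}(x,\beta,\gamma)=\sum_{k=0}^{n}\frac{(q^{-n};q)_k(q^{-x};q)_k}{(\beta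 q;q)_k(q;q)_k}(-\gamma^{-1}q^{n+1})^k$ are defined by the same formula also for negative $\beta$. *)

(* Defs.v *)
From mathcomp Require Import all_boot all_order all_algebra.
From mathcomp Require Import all_classical all_reals all_analysis.
Set Implicit Arguments.
Unset Strict Implicit.
Unset Printing Implicit Defensive.
Import Order.TTheory GRing.Theory Num.Theory numFieldNormedType.Exports.
Local Open Scope classical_set_scope.
Local Open Scope ring_scope.

(* (a; q)_n *)
Definition qpoch (R : realType) (q a : R) (n : nat) : R :=
  \prod_(i < n) (1 - a * q ^+ i).

(* (a; q)_oo; the limit exists whenever 0 < q < 1 *)
Definition qpoch_inf (R : realType) (q a : R) : R := limn (qpoch q a).

(* q-Hahn weight; only meaningful for z <= y, since y - z is truncated *)
Definition qHahn (R : realType) (q : R) (z y : nat) (a b : R) : R :=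
  qpoch q q y / (qpoch q q z * qpoch q q (y - z)) *
  (qpoch q a z * qpoch q b (y - z) * a ^+ (y - z) / qpoch q (a * b) y).

Definition qMeixner (R : realType) (q : R) (x : nat) (beta gamma : R) : R :=
  qpoch q (beta * q) x / (qpoch q q x * qpoch q (- (beta * gamma * q)) x) *
  gamma ^+ x * q ^+ 'C(x, 2) *
  (qpoch_inf q (- (beta * gamma * q)) / qpoch_inf q (- gamma)).

Definition qMeixner_poly (R : realType) (q : R) (n x : nat)
    (beta gamma : R) : R :=
  \sum_(0 <= k < n.+1)
    qpoch q (q ^- n) k * qpoch q (q ^- x) k /
    (qpoch q (beta * q) k * qpoch q q k) *
    (- (gamma^-1 * q ^+ n.+1)) ^+ k.

(* the weight pi'(z1, y); only meaningful for y <= z1, where the truncated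
   subtractions of naturals (including that of the binomials) are exact *)
Definition upWeight (R : realType) (q a2 b2 : R) (z1 y : nat) : R :=
  qpoch q (- (a2^-1 * b2)) y * qpoch q a2 (z1 - y) *
  (a2^-1 * b2) ^+ (z1 - y) * q ^+ ('C(z1, 2) - 'C(y, 2)) /
  (qpoch q (- b2) z1 * qpoch q q (z1 - y)) *
  (qpoch_inf q (- b2) / qpoch_inf q (- (a2^-1 * b2))).

Definition innerTerm (R : realType) (q b1 a2 b2 : R)
    (x y z2 z1 : nat) : R :=
  qHahn q (x - z2) (z1 - z2) b1 a2 * upWeight q a2 b2 z1 y.

Definition kernelK (R : realType) (q a1 b1 a2 b2 : R) (x y : nat) : R :=
  \sum_(0 <= z2 < (minn x y).+1)
    qHahn q z2 y a1 b1 *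
    \big[+%R/0]_(maxn x y <= z1 <oo) innerTerm q b1 a2 b2 x y z2 z1.

Definition kappa (R : realType) (q a1 b1 a2 : R) (n : nat) : R :=
  \sum_(0 <= k < n.+1)
    qpoch q (q ^- n) k * qpoch q b1 k * qpoch q a2 k /
    (qpoch q (a1 * b1) k * qpoch q (b1 * a2) k * qpoch q q k) *
    (a1 * b1 * q ^+ n) ^+ k.

Definition STerm (R : realType) (q a1 b1 a2 b2 : R) (k j : nat) : R :=
  qpoch q a1 j * qpoch q (a2 * q ^+ k) j *
  qpoch q (- (a2^-1 * b2 * q ^+ k)) j /
  (qpoch q (- (b2 * q ^+ k)) j * qpoch q (a1 * b1 * q ^+ k) j *
   qpoch q q j) * b1 ^+ j.

Definition SSum (R : realType) (q a1 b1 a2 b2 : R) (k : nat) : R :=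
  \big[+%R/0]_(0 <= j <oo) STerm q a1 b1 a2 b2 k j.

Definition kappa_minus (R : realType) (q a1 b1 a2 b2 : R) (n : nat) : R :=
  qpoch_inf q b1 * qpoch_inf q (- b2) /
  (qpoch_inf q (b1 * a2) * qpoch_inf q (- (a2^-1 * b2))) *
  \sum_(0 <= k < n.+1)
    qpoch q (q ^- n) k * qpoch q b1 k * qpoch q a2 k /
    (qpoch q (- b2) k * qpoch q (a1 * b1) k) *
    ((- (a2^-1 * b2 * q ^+ n)) ^+ k / qpoch q q k) *
    SSum q a1 b1 a2 b2 k.

Definition vMinus (R : realType) (q a1 b1 a2 b2 : R) (n x : nat) : R :=
  (-1) ^+ x * (q ^+ 'C(x, 2) / qpoch q q x) *
  qMeixner_poly q n x (- (a2^-1 * b2 * q^-1)) (a1 * b1 * a2 * b2^-1).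

(* Main.v *)
(** Up to a constant, K(x,y) pi(y) is b1^-(x+y) times a sum over (z1,z2) of
    rho(z1,z2) c(x;z1,z2) c(y;z1,z2), which is symmetric in x and y.
    Let c = a1 b1 and d = - b2 / a2. The polynomials P_n satisfy the q-Meixner
    difference equation H f = lambda f, where H is a birth and death operator;
    so do the functions v_n / pi, because conjugating H by
    (d;q)_x (c/d)^x / (c;q)_x exchanges c and d up to an affine change.
    The operator H in the variable x, applied to c(x;z1,z2), is a difference
    operator in (z1,z2) which is self-adjoint with respect to rho; hence K
    commutes with H. A solution of H f = lambda f on the nonnegative integers
    is determined by f(0), so each solution f of exponential growth satisfies
    sum_y K(y,x) f(y) = kappa f(x), and kappa is read off at x = 0. For P_n
    this value follows from the q-Vandermonde and 1phi1 sums; for the second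
    family, from the transformation of a 2phi2 into a 2phi1 and a summation
    along diagonals. The case P_0 = 1, kappa(0) = 1 is the normalization of K. *)
Require Import Defs.
From mathcomp Require Import all_boot all_order all_algebra.
From mathcomp Require Import all_classical all_reals all_analysis.
From mathcomp Require Import ring lra zify.
Set Implicit Arguments.
Unset Strict Implicit.
Unset Printing Implicit Defensive.
Import Order.TTheory GRing.Theory Num.Theory numFieldNormedType.Exports.
Local Open Scope classical_set_scope.
Local Open Scope ring_scope.

(** * Growth conditions and rearrangement of series *)

Section GeometricDomination.
Variable R : realType.
Implicit Types (u f g : nat -> R) (r C : R).

(** In the parameters c and d both polynomial families are [mpoly], with c and d exchanged. As d <
    0, the products (d; q)_n and (a2 d; q)_n are at least 1, so they are harmless in denominators.
    The obstacle is convergence. P_n(x) can grow like q^(-n x), so sums against it need decay in y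
    faster than any exponential. [core x y] has this decay, since the terms of its series vanish for
    z1 < y and carry q ^+ 'C(z1, 2). The same decay removes the boundary terms of the summations by
    parts and permits summing over y first at fixed z1. The value at x = 0 is tractable because x =
    0 forces z2 = 0, and at fixed z1 the remaining dependence on y is a q-Hahn weight. For the
    second family the extra factor (d; q)_y / (c; q)_y spoils this q-Vandermonde structure; so each
    [core 0 y] is first rewritten as a series in which y and the summation index r enter most
    factors only through y + r. *)

Definition geom_bounded u r := exists C, forall n, `|u n| <= C * r ^+ n.

(** Superexponential decay, modelled on q ^+ 'C(n, 2); it survives multiplication by any function of
    exponential growth. *)
Definition rapid u := forall r, 0 < r -> geom_bounded u r.

Lemma geom_bounded_ge0 u r : geom_bounded u r ->
  exists2 C, 0 <= C & forall n, `|u n| <= C * r ^+ n.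
Proof.
case=> C hC; exists C => //.
by have := hC 0%N; rewrite expr0 mulr1; apply: le_trans.
Qed.

Lemma geom_boundedM u f r s : geom_bounded u r -> geom_bounded f s ->
  geom_bounded (fun n => u n * f n) (r * s).
Proof.
move=> [C hC] [D hD]; exists (C * D) => n.
by rewrite normrM exprMn mulrACA ler_pM.
Qed.

Lemma geom_bounded1M u f : geom_bounded u 1 -> geom_bounded f 1 ->
  geom_bounded (fun n => u n * f n) 1.
Proof. by move=> hu hf; have := geom_boundedM hu hf; rewrite mulr1. Qed.

Lemma geom_boundedD u f r : geom_bounded u r -> geom_bounded f r ->
  geom_bounded (fun n => u n + f n) r.
Proof.
move=> [C hC] [D hD]; exists (C + D) => n.
by rewrite mulrDl (le_trans (ler_normD _ _)) // lerD.
Qed.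

Lemma geom_boundedB u f r : geom_bounded u r -> geom_bounded f r ->
  geom_bounded (fun n => u n - f n) r.
Proof.
move=> [C hC] [D hD]; exists (C + D) => n.
by rewrite mulrDl (le_trans (ler_normB _ _)) // lerD.
Qed.

Lemma geom_bounded_sum (I : Type) (s : seq I) (F : I -> nat -> R) r : 0 <= r ->
  (forall i, geom_bounded (F i) r) ->
  geom_bounded (fun n => \sum_(i <- s) F i n) r.
Proof.
move=> r0 hF; elim: s => [|i s IH].
  by exists 0 => n; rewrite big_nil normr0 mul0r.
case: (geom_boundedD (hF i) IH) => C hC.
by exists C => n; rewrite big_cons.
Qed.

Lemma geom_bounded_cst (c : R) : geom_bounded (fun=> c) 1.
Proof. by exists `|c| => n; rewrite expr1n mulr1. Qed.

Lemma geom_bounded_exp (c : R) : geom_bounded (fun n => c ^+ n) `|c|.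
Proof. by exists 1 => n; rewrite normrX mul1r. Qed.

Lemma geom_bounded_le u r s : 0 <= r -> r <= s -> geom_bounded u r ->
  geom_bounded u s.
Proof.
move=> r0 rs /geom_bounded_ge0[C C0 hC]; exists C => n.
by rewrite (le_trans (hC n)) // ler_wpM2l // lerXn2r // nnegrE (le_trans r0 rs).
Qed.

Lemma geom_boundedS u r : 0 <= r -> geom_bounded u r ->
  geom_bounded (fun n => u n.+1) r.
Proof.
move=> r0 [C hC]; exists (C * r) => n.
by rewrite (le_trans (hC _)) // exprS mulrA.
Qed.

Lemma rapidMgeom u f s : 0 < s -> rapid u -> geom_bounded f s ->
  rapid (fun n => u n * f n).
Proof.
move=> s0 hu hf r r0; have rs : 0 < r / s by rewrite divr_gt0.
by have := geom_boundedM (hu _ rs) hf; rewrite divfK // gt_eqF.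
Qed.

Lemma rapidMbounded u f : rapid u -> geom_bounded f 1 ->
  rapid (fun n => u n * f n).
Proof. exact: rapidMgeom. Qed.

Lemma rapidD u f : rapid u -> rapid f -> rapid (fun n => u n + f n).
Proof. by move=> hu hf r r0; apply: geom_boundedD; [exact: hu|exact: hf]. Qed.

Lemma rapidS u : rapid u -> rapid (fun n => u n.+1).
Proof. by move=> hu r r0; apply: geom_boundedS; [exact: ltW|exact: hu]. Qed.

Lemma eq_rapid u f : u =1 f -> rapid u -> rapid f.
Proof. by move=> /funext ->. Qed.

Lemma rapid_sum (I : Type) (s : seq I) (F : I -> nat -> R) :
  (forall i, rapid (F i)) -> rapid (fun n => \sum_(i <- s) F i n).
Proof.
by move=> hF r r0; apply: geom_bounded_sum => [|i]; [exact: ltW|exact: hF].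
Qed.

(** The rate is kept positive because [rapidMgeom] divides by it. *)
Definition exp_bounded u := exists2 s, 0 < s & geom_bounded u s.

Lemma exp_boundedD u f : exp_bounded u -> exp_bounded f ->
  exp_bounded (fun n => u n + f n).
Proof.
move=> [s s0 hu] [t t0 hf]; exists (s + t); first exact: addr_gt0.
by apply: geom_boundedD; [move: hu|move: hf]; apply: geom_bounded_le; rewrite ?lerDl ?lerDr // ltW.
Qed.

Lemma exp_boundedM u f : exp_bounded u -> exp_bounded f ->
  exp_bounded (fun n => u n * f n).
Proof.
move=> [s s0 hu] [t t0 hf]; exists (s * t); first exact: mulr_gt0.
exact: geom_boundedM.
Qed.

Lemma bounded_exp_bounded u : geom_bounded u 1 -> exp_bounded u.
Proof. by exists 1. Qed.

Lemma exp_bounded_exp (c : R) : exp_bounded (fun n => c ^+ n).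
Proof.
exists (`|c| + 1); first by rewrite ltr_wpDl.
by apply: geom_bounded_le (geom_bounded_exp c) => //; rewrite lerDl.
Qed.

Lemma exp_bounded_sum (I : Type) (s : seq I) (F : I -> nat -> R) :
  (forall i, exp_bounded (F i)) -> exp_bounded (fun n => \sum_(i <- s) F i n).
Proof.
move=> hF; elim: s => [|i s [t t0 IH]].
  by exists 1 => //; exists 0 => n; rewrite big_nil normr0 mul0r.
have [t' t'0 [C hC]] := exp_boundedD (hF i) (ex_intro2 _ _ t t0 IH).
by exists t' => //; exists C => n; rewrite big_cons.
Qed.

Lemma geom_bounded_cvg0 u r : 0 <= r < 1 -> geom_bounded u r -> u @ \oo --> (0 : R).
Proof.
move=> /andP[r0 r1] [C hC].
apply: norm_cvg0.
apply: (@squeeze_cvgr _ _ _ _ (fun=> 0) (fun n => C * r ^+ n)).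
- by near=> n; rewrite normr_ge0 hC.
- exact: cvg_cst.
- have := @cvg_geometric R C r; rewrite ger0_norm // => /(_ r1); exact.
Unshelve. all: by end_near. Qed.

Lemma geom_bounded_is_cvg u r : 0 <= r < 1 -> geom_bounded u r -> cvgn (series u).
Proof.
move=> /andP[r0 r1] /geom_bounded_ge0[C C0 hC].
apply: normed_cvg; apply: (@series_le_cvg _ _ (geometric C r)) => [n|n|n|].
- exact: normr_ge0.
- by rewrite /= mulr_ge0 // exprn_ge0.
- exact: hC.
- by apply: is_cvg_geometric_series; rewrite ger0_norm.
Qed.

Lemma geom_series_norm_le u r C : 0 <= r < 1 -> (forall n, `|u n| <= C * r ^+ n) ->
  `|limn (series u)| <= C / (1 - r).
Proof.
move=> hr hC; have [r0 r1] := andP hr.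
have cv := geom_bounded_is_cvg hr (ex_intro _ C hC).
have C0 : 0 <= C by have := hC 0%N; rewrite expr0 mulr1; apply: le_trans.
have d : 0 < 1 - r by rewrite subr_gt0.
have part n : `|series u n| <= C / (1 - r).
  rewrite /series /= (le_trans (ler_norm_sum _ _ _)) //.
  rewrite (le_trans (ler_sum_nat (fun i _ => hC i))) //.
  have -> : \sum_(0 <= i < n) C * r ^+ i = series (geometric C r) n by [].
  rewrite geometric_seriesE ?lt_eqF //=; apply: ler_wpM2r; first by rewrite invr_ge0 ltW.
  by rewrite ler_piMr // lerBlDr lerDl exprn_ge0.
rewrite ler_norml; apply/andP; split.
- by apply: limr_ge => //; near=> n; have := part n; rewrite ler_norml => /andP[].
- by apply: limr_le => //; near=> n; have := part n; rewrite ler_norml => /andP[].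
Unshelve. all: by end_near. Qed.
End GeometricDomination.

(** * Linear operations, shifts and diagonal summation of series *)

Section Rearrangement.
Variable R : realType.
Implicit Types (u f g : nat -> R) (r c C : R).

Lemma cvg_seriesZ u c (l : R) : series u @ \oo --> l ->
  series (fun n => c * u n) @ \oo --> c * l.
Proof.
have -> : series (fun n => c * u n) = (fun n => c * series u n).
  by apply/funext => n; rewrite /series /= mulr_sumr.
exact: cvgMr.
Qed.

Lemma cvg_seriesD u f (l m : R) : series u @ \oo --> l -> series f @ \oo --> m ->
  series (fun n => u n + f n) @ \oo --> l + m.
Proof.
have -> : series (fun n => u n + f n) = (fun n => series u n + series f n).
  by apply/funext => n; rewrite /series /= big_split.
exact: cvgD.
Qed.

Lemma cvg_seriesB u f (l m : R) : series u @ \oo --> l -> series f @ \oo --> m ->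
  series (fun n => u n - f n) @ \oo --> l - m.
Proof.
have -> : series (fun n => u n - f n) = (fun n => series u n - series f n).
  by apply/funext => n; rewrite /series /= sumrB.
exact: cvgB.
Qed.

Lemma cvg_series_sum (I : Type) (s : seq I) (F : I -> nat -> R) (l : I -> R) :
  (forall i, series (F i) @ \oo --> l i) ->
  series (fun n => \sum_(i <- s) F i n) @ \oo --> \sum_(i <- s) l i.
Proof.
move=> hF; elim: s => [|i s IH].
  rewrite big_nil (_ : series _ = fun=> 0); first exact: cvg_cst.
  by apply/funext => n; rewrite /series /= big1 // => i _; rewrite big_nil.
rewrite big_cons (_ : (fun n => _) = fun n => F i n + \sum_(j <- s) F j n).
  by apply: cvg_seriesD.
by apply/funext => n; rewrite big_cons.
Qed.

Lemma eq_cvg_series u f (l : R) : u =1 f -> series u @ \oo --> l -> series f @ \oo --> l.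
Proof. by move=> /funext ->. Qed.

Lemma cvg_series_unique u (l m : R) : series u @ \oo --> l -> series u @ \oo --> m -> l = m.
Proof. exact: cvg_unique. Qed.

(** Each functional equation below is obtained this way: the combination of series that should
    vanish has terms G (m + 1) - G m, with G zero at 0 and at infinity. *)
Lemma cvg_series_telescope (G : nat -> R) : G 0%N = 0 -> G @ \oo --> (0 : R) ->
  series (fun m => G m.+1 - G m) @ \oo --> (0 : R).
Proof.
move=> G0 cG; have -> // : series (fun m => G m.+1 - G m) = G.
by apply/funext => n; rewrite /series /= telescope_sumr // G0 subr0.
Qed.

Lemma series_shift u k n : series u (n + k)%N = series u k + series (fun i => u (i + k)%N) n.
Proof.
elim: n => [|n IH]; first by rewrite add0n /series /= [X in _ + X]big_geq // addr0.
by rewrite addSn !seriesSr IH addrA.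
Qed.

Lemma cvg_series_shift u k (l : R) : series u @ \oo --> l ->
  series (fun i => u (i + k)%N) @ \oo --> l - series u k.
Proof.
move=> ul.
have -> : series (fun i => u (i + k)%N) = (fun n => series u (n + k)%N - series u k).
  by apply/funext => n; rewrite series_shift addrC addKr.
apply: cvgB; last exact: cvg_cst.
by rewrite (cvg_shiftn k (series u) (nbhs l)).
Qed.

Lemma geom_series_tail_le u r C k : 0 <= r < 1 -> (forall n, `|u n| <= C * r ^+ n) ->
  `|limn (series u) - series u k| <= C * r ^+ k / (1 - r).
Proof.
move=> hr hC.
have cv : cvgn (series u) by apply: (geom_bounded_is_cvg hr); exists C.
have /cvg_lim <- // := cvg_series_shift (k := k) cv.
apply: geom_series_norm_le => // n.
by rewrite (le_trans (hC _)) // exprD mulrA mulrAC.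
Qed.

Lemma geom_bounded_natr (t : R) : 1 < t -> geom_bounded (fun n => n%:R : R) t.
Proof.
move=> t1; exists (t - 1)^-1 => n; have d : 0 < t - 1 by rewrite subr_gt0.
rewrite normr_nat mulrC ler_pdivlMr //; elim: n => [|n IH].
  by rewrite mul0r expr0.
rewrite exprS -natr1; apply: (@le_trans _ _ (t ^+ n + (t - 1))); first by lra.
have : 1 <= t ^+ n by rewrite exprn_ege1 // ltW.
nra.
Qed.

Lemma cvg_natr_expr0 r : 0 <= r < 1 -> (fun n => n%:R * r ^+ n) @ \oo --> (0 : R).
Proof.
(* The inverse of the mean of 1 and r: larger than 1, so t ^+ n dominates n, while still t * r <
   1. *)
move=> /andP[r0 r1]; pose t := 2 / (1 + r).
have d : 0 < 1 + r by lra.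
have t1 : 1 < t by rewrite /t ltr_pdivlMr //; lra.
have tr : 0 <= t * r < 1.
  apply/andP; split; first by rewrite mulr_ge0 // ltW // (lt_trans _ t1).
  by rewrite /t mulrAC ltr_pdivrMr //; lra.
apply: (geom_bounded_cvg0 tr).
apply: geom_boundedM (geom_bounded_natr t1) _.
by have := geom_bounded_exp r; rewrite ger0_norm.
Qed.

Lemma series_diagonal (T : nat -> nat -> R) N :
  series (fun n => \sum_(i < n.+1) T (n - i)%N i) N =
  \sum_(0 <= i < N) series (T^~ i) (N - i)%N.
Proof.
elim: N => [|N IH]; first by rewrite /series /= !big_geq.
rewrite seriesSr IH big_mkord [RHS]big_mkord !big_ord_recr /= subnn.
rewrite [X in _ = _ + X](_ : _ = T 0 N); last first.
  by rewrite subSn // subnn /series /= big_nat1.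
rewrite addrA -big_split /=; congr (_ + _); apply: eq_bigr => i _.
by rewrite subSn 1?ltnW // seriesSr.
Qed.

(** The first N diagonals consist of columns truncated at height N - i. The missing tail of column i
    is at most C r^i r^(N-i) / (1 - r), independent of i, so the N columns together err by a
    multiple of N r^N, which tends to 0. *)
Lemma cvg_series_diagonal (T : nat -> nat -> R) r C : 0 <= r < 1 ->
  (forall m i, `|T m i| <= C * r ^+ (m + i)) ->
  exists L : R, series (fun i => limn (series (T^~ i))) @ \oo --> L /\
    series (fun n => \sum_(i < n.+1) T (n - i)%N i) @ \oo --> L.
Proof.
move=> hr hC; have [r0 r1] := andP hr.
have d : 0 < 1 - r by rewrite subr_gt0.
have hC' i m : `|T m i| <= C * r ^+ i * r ^+ m by rewrite -mulrA -exprD addnC.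
set s := fun i => limn (series (T^~ i)).
have sb i : `|s i| <= C / (1 - r) * r ^+ i.
  by rewrite mulrAC; apply: (geom_series_norm_le hr (hC' i)).
have cs : cvgn (series s) by apply: (geom_bounded_is_cvg hr); exists (C / (1 - r)).
exists (limn (series s)); split; first exact: cs.
set D := series _.
have dist N : `|series s N - D N| <= (C / (1 - r)) * (N%:R * r ^+ N).
  rewrite /D series_diagonal /series /= -sumrB.
  rewrite (le_trans (ler_norm_sum _ _ _)) //.
  apply: (@le_trans _ _ (\sum_(0 <= i < N) C * r ^+ N / (1 - r))).
    apply: ler_sum_nat => i /andP[_ iN].
    rewrite (le_trans (geom_series_tail_le (N - i)%N hr (hC' i))) //.
    by rewrite -[C * _ * _]mulrA -exprD subnKC // ltnW.
  by rewrite sumr_const_nat subn0 -mulr_natl le_eqVlt; apply/orP; left; apply/eqP; ring.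
rewrite (_ : D = (fun N => series s N - (series s N - D N))); last first.
  by apply/funext => N; rewrite subKr.
rewrite -[X in _ --> X]subr0; apply: cvgB => //.
apply: norm_cvg0.
apply: (@squeeze_cvgr _ _ _ _ (fun=> 0) (fun N => (C / (1 - r)) * (N%:R * r ^+ N))).
- by near=> n; rewrite normr_ge0 dist.
- exact: cvg_cst.
- by rewrite -[X in _ --> X](mulr0 (C / (1 - r))); apply: cvgMr; apply: cvg_natr_expr0.
Unshelve. all: by end_near. Qed.
End Rearrangement.

(** * Basic hypergeometric series *)

Section QPochhammer.
Variables (R : realType) (q : R).
Hypothesis hq : 0 < q < 1.
Implicit Types (a b c d e z : R) (k m n : nat).

Local Notation qp := (qpoch q).

Let q_gt0 : 0 < q. Proof. by case/andP: hq. Qed.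
Let q_lt1 : q < 1. Proof. by case/andP: hq. Qed.

Lemma qpoch0 a : qp a 0 = 1.
Proof. by rewrite /qpoch big_ord0. Qed.

Lemma qpochS a n : qp a n.+1 = qp a n * (1 - a * q ^+ n).
Proof. by rewrite /qpoch big_ord_recr. Qed.

Lemma qpochD a m n : qp a (m + n) = qp a m * qp (a * q ^+ m) n.
Proof.
elim: n => [|n IH]; first by rewrite addn0 qpoch0 mulr1.
by rewrite addnS !qpochS IH -!mulrA -exprD.
Qed.

Lemma qpochSl a n : qp a n.+1 = (1 - a) * qp (a * q) n.
Proof. by rewrite -add1n qpochD qpochS qpoch0 mul1r mulr1. Qed.

Lemma qexp_gt0 n : 0 < q ^+ n. Proof. exact: exprn_gt0. Qed.
Lemma qexp_le1 n : q ^+ n <= 1. Proof. by apply: exprn_ile1; apply: ltW. Qed.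

(** No lower bound on a: the lemmas built on this serve the negative parameters d and a2 d as well
    as those in (0, 1). *)
Lemma mul_qexp_lt1 a n : a < 1 -> a * q ^+ n < 1.
Proof.
move=> a1; have [a0|a0] := lerP a 0.
  by rewrite (@le_lt_trans _ _ 0) // pmulr_lle0 // qexp_gt0.
by rewrite (@le_lt_trans _ _ a) // ler_piMr ?qexp_le1 // ltW.
Qed.

Lemma qexpS_neq1 n : 1 - q ^+ n.+1 != 0.
Proof. by rewrite exprS subr_eq0 eq_sym lt_eqF // mul_qexp_lt1. Qed.

Lemma qfactor_neq0 a n : a < 1 -> 1 - a * q ^+ n != 0.
Proof. by move=> a1; rewrite subr_eq0 eq_sym lt_eqF // mul_qexp_lt1. Qed.

Lemma qpoch_gt0 a n : a < 1 -> 0 < qp a n.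
Proof.
by move=> a1; rewrite /qpoch prodr_gt0 // => i _; rewrite subr_gt0 mul_qexp_lt1.
Qed.

Lemma qpoch_neq0 a n : a < 1 -> qp a n != 0.
Proof. by move=> a1; rewrite gt_eqF // qpoch_gt0. Qed.

Lemma qfact_neq0 n : qp q n != 0. Proof. exact: qpoch_neq0. Qed.


(** The inequality 1 + x <= exp x turns the product into the exponential of a geometric sum, which
    is bounded uniformly in n. *)
Lemma prod_qbound (f : nat -> R) C n : 0 <= C ->
  (forall i, `|f i| <= 1 + C * q ^+ i) -> `|\prod_(i < n) f i| <= expR (C / (1 - q)).
Proof.
move=> C0 hf; have d : 0 < 1 - q by rewrite subr_gt0.
rewrite normr_prod (@le_trans _ _ (expR (\sum_(i < n) C * q ^+ i))) //.
  rewrite expR_sum; apply: ler_prod => i _; rewrite normr_ge0 /=.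
  by rewrite (le_trans (hf i)) // expR_ge1Dx.
rewrite ler_expR -mulr_sumr ler_wpM2l //.
have e : (1 - q) * (\sum_(i < n) q ^+ i) = 1 - q ^+ n.
  by rewrite -[RHS]opprB subrX1 -mulNr opprB.
rewrite -[leLHS](mulKf (lt0r_neq0 d)) e ler_piMr //; first by rewrite invr_ge0 ltW.
by rewrite gerBl ltW // qexp_gt0.
Qed.

Lemma qpoch_geom_bounded a : geom_bounded (qp a) 1.
Proof.
exists (expR (`|a| / (1 - q))) => n; rewrite expr1n mulr1.
apply: (@prod_qbound (fun i => 1 - a * q ^+ i)) => // i.
by rewrite (le_trans (ler_normB _ _)) // normr1 normrM (ger0_norm (ltW (qexp_gt0 i))).
Qed.

Lemma qpochV_geom_bounded a : a < 1 -> geom_bounded (fun n => (qp a n)^-1) 1.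
Proof.
move=> a1; have [a0|a0] := lerP a 0.
  exists 1 => n; rewrite expr1n mulr1 normfV invf_le1 ?normr_gt0 ?qpoch_neq0 //.
  rewrite ger0_norm ?(ltW (qpoch_gt0 _ _)) //.
  elim: n => [|n IH]; first by rewrite qpoch0.
  by rewrite qpochS; apply: mulr_ege1 => //; rewrite lerBrDr gerDl pmulr_lle0 // qexp_gt0.
have d : 0 < 1 - a by rewrite subr_gt0.
(* The slope a / (1 - a) is that of the chord of the convex function Q -> 1 / (1 - a Q) over [0, 1],
   so the chord lies above the function. *)
exists (expR (a / (1 - a) / (1 - q))) => n; rewrite expr1n mulr1 /qpoch -prodfV.
apply: (@prod_qbound (fun i => (1 - a * q ^+ i)^-1)) => [|i].
  by rewrite divr_ge0 // ltW.
have f0 : 0 < 1 - a * q ^+ i by rewrite subr_gt0 mul_qexp_lt1.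
rewrite ger0_norm; last by rewrite invr_ge0 ltW.
rewrite -[leLHS]mul1r ler_pdivrMr //.
have := qexp_gt0 i; have := qexp_le1 i; set Q := q ^+ i => Q1 Q0.
suff : 0 <= (1 + a / (1 - a) * Q) * (1 - a * Q) - 1 by rewrite subr_ge0.
have -> : (1 + a / (1 - a) * Q) * (1 - a * Q) - 1 = a ^+ 2 * Q * (1 - Q) / (1 - a).
  by field; rewrite gt_eqF.
by rewrite divr_ge0 ?mulr_ge0 ?sqr_ge0 ?subr_ge0 // ltW.
Qed.

(** The increments of (a; q)_n are - a q^n (a; q)_n and the products are bounded, so the limit is
    the sum of a geometrically dominated series. *)
Lemma cvg_qpoch a : qp a @ \oo --> qpoch_inf q a.
Proof.
suff : cvgn (qp a) by [].
have -> : qp a = (fun n => 1 + series (fun k => - (a * q ^+ k) * qp a k) n).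
  apply/funext => n; elim: n => [|n IH].
    by rewrite qpoch0 /series /= big_geq // addr0.
  by rewrite seriesSr addrA -IH qpochS; ring.
apply: is_cvgD; first exact: is_cvg_cst.
apply: (@geom_bounded_is_cvg _ _ q); first by rewrite ltW.
case: (qpoch_geom_bounded a) => C hC; exists (`|a| * C) => n.
rewrite normrM normrN normrM (ger0_norm (ltW (qexp_gt0 n))) mulrAC ler_wpM2r //.
  by rewrite ltW // qexp_gt0.
by rewrite ler_wpM2l // (le_trans (hC n)) // expr1n mulr1.
Qed.

Lemma qpoch_infD a n : qpoch_inf q a = qp a n * qpoch_inf q (a * q ^+ n).
Proof.
have h1 : (fun m => qp a (m + n)) @ \oo --> qpoch_inf q a.
  by rewrite (cvg_shiftn n (qp a) (nbhs (qpoch_inf q a))); apply: cvg_qpoch.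
have h2 : (fun m => qp a (m + n)) @ \oo --> qp a n * qpoch_inf q (a * q ^+ n).
  rewrite (_ : (fun m => _) = (fun m => qp a n * qp (a * q ^+ n) m)); last first.
    by apply/funext => m; rewrite addnC qpochD.
  by apply: cvgMr; apply: cvg_qpoch.
exact: (cvg_unique _ h1 h2).
Qed.

Lemma qpoch_inf_gt0 a : a < 1 -> 0 < qpoch_inf q a.
Proof.
move=> a1; have [C C0 hC] := geom_bounded_ge0 (qpochV_geom_bounded a1).
have C1 : 0 < 1 + C by rewrite ltr_pwDl.
apply: (@lt_le_trans _ _ (1 + C)^-1); first by rewrite invr_gt0.
apply: limr_ge; first exact: cvg_qpoch.
near=> n; have := hC n; have p := qpoch_gt0 n a1.
rewrite expr1n mulr1 ger0_norm => [h|]; last by rewrite invr_ge0 ltW.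
by rewrite -[leRHS]invrK lef_pV2 ?posrE ?invr_gt0 // (le_trans h) // lerDr.
Unshelve. all: by end_near. Qed.

Lemma qpoch_inf_neq0 a : a < 1 -> qpoch_inf q a != 0.
Proof. by move=> a1; rewrite gt_eqF // qpoch_inf_gt0. Qed.

Lemma rapid_qbin : rapid (fun n => q ^+ 'C(n, 2)).
Proof.
move=> r r0.
have [k kr] : exists k, q ^+ k <= r.
  have /cvgrPdist_lt /(_ _ r0) [k _ hk] : (fun n => q ^+ n) @ \oo --> (0 : R).
    by apply: cvg_expr; rewrite ger0_norm // ltW.
  by exists k; have := hk k (leqnn k); rewrite /= sub0r normrN (gtr0_norm (qexp_gt0 k)) => /ltW.
(* As q ^+ k <= r, it suffices that k n <= 'C(n, 2) + k^2. Passing from n to n + 1 adds n to the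
   right side, enough once n >= k; for n < k the term k^2 alone covers k (n + 1). *)
exists (q ^- (k ^ 2)) => n.
rewrite (gtr0_norm (qexp_gt0 _)) mulrC ler_pdivlMr ?qexp_gt0 // -exprD.
apply: (@le_trans _ _ ((q ^+ k) ^+ n)); last by rewrite lerXn2r // nnegrE ltW // qexp_gt0.
rewrite -exprM ler_wiXn2l ?ltW // addnC.
elim: n => [|n IH]; first by rewrite muln0.
rewrite binS bin1; have [kn|nk] := leqP k n; first by rewrite mulnS; lia.
by apply: (@leq_trans (k * k)); [rewrite leq_mul|rewrite -mulnn; lia].
Qed.
Lemma qexp_bounded : geom_bounded (fun n => q ^+ n) 1.
Proof. by exists 1 => n; rewrite expr1n mulr1 (gtr0_norm (qexp_gt0 n)) qexp_le1. Qed.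

End QPochhammer.

(** * Finite q-Vandermonde sums and the q-binomial theorem *)

Section SummationFormulas.
Variables (R : realType) (q : R).
Hypothesis hq : 0 < q < 1.
Implicit Types (a b c d e z : R) (k m n : nat).

Local Notation qp := (qpoch q).
Local Notation qi := (qpoch_inf q).

Let q_gt0 : 0 < q. Proof. by case/andP: hq. Qed.
Let q_lt1 : q < 1. Proof. by case/andP: hq. Qed.
Let qf_neq0 n : qp q n != 0. Proof. exact: qfact_neq0. Qed.

(* The q-Pascal rule, as a recurrence for the sums of q-binomial type. *)
Lemma qconv_rec (F : nat -> R) n :
  (1 - q ^+ n.+1) * (\sum_(i < n.+2) F i / (qp q i * qp q (n.+1 - i))) =
  \sum_(i < n.+1) (F i.+1 + q ^+ i * F i) / (qp q i * qp q (n - i)).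
Proof.
have split_i (i : nat) : (i <= n.+1)%N ->
  (1 - q ^+ n.+1) * (F i / (qp q i * qp q (n.+1 - i))) =
  (1 - q ^+ i) * (F i / (qp q i * qp q (n.+1 - i))) +
  (1 - q ^+ (n.+1 - i)) * (q ^+ i * (F i / (qp q i * qp q (n.+1 - i)))).
  by move=> le_in; rewrite -{1}(subnKC le_in) exprD; ring.
rewrite mulr_sumr; rewrite (eq_bigr _ (fun (i : 'I_n.+2) _ => split_i i (leq_ord i))).
under [RHS]eq_bigr => i _ do rewrite mulrDl.
rewrite !big_split /=; congr (_ + _).
- rewrite big_ord_recl /= expr0 subrr mul0r add0r; apply: eq_bigr => i _.
  rewrite /bump /= add1n subSS qpochS -exprS.
  have := qexpS_neq1 hq i; have := qf_neq0 i; have := qf_neq0 (n - i).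
  by move=> h1 h2 h3; field; rewrite h1 h2 h3.
- rewrite big_ord_recr /= subnn expr0 subrr mul0r addr0; apply: eq_bigr => i _.
  rewrite (subSn (leq_ord i)) qpochS -exprS.
  have := qexpS_neq1 hq (n - i); have := qf_neq0 i; have := qf_neq0 (n - i).
  by move=> h1 h2 h3; field; rewrite h1 h2 h3.
Qed.

(** After [qconv_rec] the two terms combine to the factor 1 - a b q^n, the same for all i, so the
    induction closes. This sum is the normalization of the q-Hahn weight. *)
Lemma qVandermonde a b n :
  \sum_(i < n.+1) qp a i * qp b (n - i) * a ^+ (n - i) / (qp q i * qp q (n - i)) =
  qp (a * b) n / qp q n.
Proof.
elim: n => [|n IH].
  by rewrite big_ord_recl big_ord0 /= !qpoch0 expr0 !mulr1 invr1 addr0.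
apply: (mulfI (qexpS_neq1 hq n)).
rewrite (qconv_rec (fun i => qp a i * qp b (n.+1 - i) * a ^+ (n.+1 - i))).
transitivity ((1 - a * b * q ^+ n) * (qp (a * b) n / qp q n)); last first.
  by rewrite !qpochS -exprS; have := qexpS_neq1 hq n; have := qf_neq0 n;
    move=> h1 h2; field; rewrite h1 h2.
rewrite -IH mulr_sumr; apply: eq_bigr => i _; rewrite [RHS]mulrA; congr (_ / _).
have le_in : (i <= n)%N by rewrite -ltnS.
have e : q ^+ n = q ^+ i * q ^+ (n - i) by rewrite -exprD subnKC.
by rewrite subSS subSn // !qpochS exprS e; ring.
Qed.

(** This is 2phi1(q^-n, b; b e; e q^n) = (e; q)_n / (b e; q)_n with the denominators (b e; q)
    cleared. The induction needs e general: the recurrence takes out the factor 1 - e and replaces e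
    by e q. *)
Lemma qVandermonde_rev b e n :
  \sum_(i < n.+1) (- e) ^+ i * q ^+ 'C(i, 2) * qp b i * qp (b * e * q ^+ i) (n - i)
     / (qp q i * qp q (n - i)) =
  qp e n / qp q n.
Proof.
elim: n e => [|n IH] e.
  by rewrite big_ord_recl big_ord0 /= !qpoch0 !expr0 !mulr1 invr1 addr0.
apply: (mulfI (qexpS_neq1 hq n)).
rewrite (qconv_rec (fun i => (- e) ^+ i * q ^+ 'C(i, 2) * qp b i *
  qp (b * e * q ^+ i) (n.+1 - i))).
transitivity ((1 - e) * (qp (e * q) n / qp q n)); last first.
  rewrite qpochSl qpochS -exprS; have := qexpS_neq1 hq n; have := qf_neq0 n.
  by move=> h1 h2; field; rewrite h1 h2.
rewrite -IH mulr_sumr; apply: eq_bigr => i _; rewrite [RHS]mulrA; congr (_ / _).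
have le_in : (i <= n)%N by rewrite -ltnS.
rewrite subSS subSn // binS bin1 (qpochS q b) qpochSl.
rewrite (_ : b * e * q ^+ i.+1 = b * e * q ^+ i * q); last by rewrite exprSr mulrA.
rewrite (_ : b * (e * q) * q ^+ i = b * e * q ^+ i * q); last by ring.
rewrite (_ : (- (e * q)) ^+ i = (- e) ^+ i * q ^+ i); last by rewrite -mulNr exprMn.
by rewrite exprD exprS; ring.
Qed.

(** The sum f satisfies (1 - z) f(z) = (1 - a z) f(q z). Iteration produces the two products, and
    f(q^n z) tends to f(0) = 1. *)
Lemma qbinomial a z : 0 <= z < 1 ->
  series (fun m => qp a m / qp q m * z ^+ m) @ \oo --> qi (a * z) / qi z.
Proof.
move=> hz; have [z0 z1] := andP hz.
have [C C0 hC] : exists2 C : R, 0 <= C & forall m, `|qp a m / qp q m| <= C.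
  have := geom_boundedM (qpoch_geom_bounded hq a) (qpochV_geom_bounded hq q_lt1).
  rewrite mul1r => /geom_bounded_ge0[C C0 hC]; exists C => // m.
  by have := hC m; rewrite expr1n mulr1.
pose u w m := qp a m / qp q m * w ^+ m.
have ub (w : R) m : 0 <= w -> `|u w m| <= C * w ^+ m.
  by move=> w0; rewrite normrM normrX (ger0_norm w0) ler_wpM2r // exprn_ge0.
have wz n : 0 <= q ^+ n * z < 1.
  rewrite mulr_ge0 ?(ltW (qexp_gt0 hq n)) //= mulrC mul_qexp_lt1 //.
have cu n : series (u (q ^+ n * z)) @ \oo --> limn (series (u (q ^+ n * z))).
  apply: (geom_bounded_is_cvg (wz n)); exists C => m; apply: ub.
  by case/andP: (wz n).
pose f n := limn (series (u (q ^+ n * z))).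
have rec n : (1 - q ^+ n * z) * f n = (1 - a * (q ^+ n * z)) * f n.+1.
  set w := q ^+ n * z; apply/eqP; rewrite -subr_eq0; apply/eqP.
  have h1 := cvg_seriesB (cvg_seriesZ (c := 1 - w) (cu n)) (cvg_seriesZ (c := 1 - a * w) (cu n.+1)).
  apply: (cvg_series_unique h1).
  pose G m := - (u w m * (1 - q ^+ m)).
  apply: (@eq_cvg_series _ (fun m => G m.+1 - G m)).
    move=> m; rewrite /G /u qpochS (qpochS q q m) -/w.
    rewrite (_ : q ^+ n.+1 * z = q * w); last by rewrite /w exprS mulrA.
    rewrite (exprMn m q w) !exprS.
    have := qexpS_neq1 hq m; rewrite exprS => h1'; have := qf_neq0 m => h2.
    by field; rewrite h1' h2.
  apply: cvg_series_telescope; first by rewrite /G expr0 subrr mulr0 oppr0.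
  have [w0 w1] := andP (wz n).
  apply: (geom_bounded_cvg0 (wz n)); exists C => m.
  rewrite normrN normrM (le_trans _ (ub w m w0)) // ler_piMr // ger0_norm.
    by rewrite gerBl ltW // (qexp_gt0 hq).
  by rewrite subr_ge0 (qexp_le1 hq).
have fE n : qp z n * f 0%N = qp (a * z) n * f n.
  elim: n => [|n IH]; first by rewrite !qpoch0.
  rewrite !qpochS mulrAC IH mulrAC -mulrA (mulrC z) rec; ring.
have f1 : f @ \oo --> (1 : R).
  rewrite (_ : f = fun n => 1 + (f n - 1)); last by apply/funext => n; rewrite addrC subrK.
  rewrite -[X in _ --> X]addr0; apply: cvgD; first exact: cvg_cst.
  apply: (@geom_bounded_cvg0 _ _ q); first by rewrite ltW.
  exists (C * z / (1 - z)) => n; have [w0 w1] := andP (wz n).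
  have := geom_series_tail_le 1 (wz n) (fun m => ub _ m w0).
  rewrite {2}/series /= big_nat1 /u !qpoch0 expr0 invr1 !mulr1 -/(f n) expr1.
  move=> /le_trans; apply.
  rewrite [leRHS](_ : _ = C * (q ^+ n * z) / (1 - z)); last by ring.
  apply: ler_wpM2l; first by rewrite (mulr_ge0 C0 w0).
  rewrite lef_pV2 ?posrE ?subr_gt0 // lerD2l lerN2 ler_piMl //.
  exact: (qexp_le1 hq).
have lim1 : (fun n => qp z n * f 0%N) @ \oo --> qi z * f 0%N.
  by apply: cvgMl; apply: cvg_qpoch.
have lim2 : (fun n => qp z n * f 0%N) @ \oo --> qi (a * z) * 1.
  rewrite (_ : (fun n => _) = fun n => qp (a * z) n * f n); last exact/funext/fE.
  by apply: cvgM => //; apply: cvg_qpoch.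
have e : qi z * f 0%N = qi (a * z) by rewrite (cvg_unique _ lim1 lim2) // mulr1.
rewrite -e mulrAC mulfV ?qpoch_inf_neq0 // mul1r.
apply: (eq_cvg_series _ (cu 0%N)) => m; by rewrite /u expr0 mul1r.
Qed.

End SummationFormulas.

(** * The 1phi1 sum and the transformation of a 2phi2 into a 2phi1 *)

Section Transformations.
Variables (R : realType) (q : R).
Hypothesis hq : 0 < q < 1.
Implicit Types (a b c d e z : R) (k m n : nat).

Local Notation qp := (qpoch q).
Local Notation qi := (qpoch_inf q).

Let q_gt0 : 0 < q. Proof. by case/andP: hq. Qed.
Let q_lt1 : q < 1. Proof. by case/andP: hq. Qed.
Let qf_neq0 n : qp q n != 0. Proof. exact: qfact_neq0. Qed.

Lemma qpoch_ge1 a n : a <= 0 -> 1 <= qp a n.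
Proof.
move=> a0; elim: n => [|n IH]; first by rewrite qpoch0.
by rewrite qpochS; apply: mulr_ege1 => //; rewrite lerBrDr gerDl pmulr_lle0 // (qexp_gt0 hq).
Qed.

(** Same scheme as for the q-binomial theorem, now iterating d -> d q. The sign of a d makes every
    denominator (a d q^n; q)_m at least 1, hence bounds uniform in n. *)
Lemma qphi11_sum a d : a * d <= 0 ->
  series (fun m => qp a m / (qp (a * d) m * qp q m) * ((- d) ^+ m * q ^+ 'C(m, 2)))
    @ \oo --> qi d / qi (a * d).
Proof.
move=> ad0.
pose u n m := qp a m / (qp (a * (d * q ^+ n)) m * qp q m) *
  ((- (d * q ^+ n)) ^+ m * q ^+ 'C(m, 2)).
have adn n : a * (d * q ^+ n) <= 0 by rewrite mulrA pmulr_lle0 // (qexp_gt0 hq).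
have adn1 n : a * (d * q ^+ n) < 1 by rewrite (le_lt_trans (adn n)).
have nz n m : qp (a * (d * q ^+ n)) m != 0 by apply: qpoch_neq0.
have [C C0 hC] : exists2 C : R, 0 <= C & forall m, `|qp a m / qp q m| <= C.
  have := geom_boundedM (qpoch_geom_bounded hq a) (qpochV_geom_bounded hq q_lt1).
  rewrite mul1r => /geom_bounded_ge0[C C0 hC]; exists C => // m.
  by have := hC m; rewrite expr1n mulr1.
(* Decay at rate 1 / (2 (|d| + 1)) absorbs |d| and leaves (q^n / 2)^m: summable already for n = 0,
   and forcing f n to its first term 1 as n grows. *)
have dd : 0 < 2 * (`|d| + 1) by rewrite mulr_gt0 // ltr_wpDl.
have [C' C'0 hC'] := geom_bounded_ge0 (rapid_qbin hq (divr_gt0 ltr01 dd)).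
have wz n : 0 <= q ^+ n / 2 < 1.
  have := qexp_gt0 hq n; have := qexp_le1 hq n; lra.
have ub n m : `|u n m| <= C * C' * (q ^+ n / 2) ^+ m.
  have -> : u n m = qp a m / qp q m * ((qp (a * (d * q ^+ n)) m)^-1 *
      ((- (d * q ^+ n)) ^+ m * q ^+ 'C(m, 2))).
    by rewrite /u; field; rewrite nz qf_neq0.
  rewrite normrM -mulrA ler_pM // normrM -[leRHS]mul1r ler_pM //.
    have h := qpoch_ge1 m (adn n).
    by rewrite ger0_norm ?invr_ge0 ?(le_trans ler01) // invf_le1 ?(lt_le_trans ltr01).
  rewrite normrM normrX normrN normrM (gtr0_norm (qexp_gt0 hq n)).
  apply: (@le_trans _ _ ((`|d| * q ^+ n) ^+ m * (C' * (1 / (2 * (`|d| + 1))) ^+ m))).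
    by apply: ler_wpM2l; rewrite ?exprn_ge0 ?mulr_ge0 // ltW // (qexp_gt0 hq).
  rewrite mulrCA ler_wpM2l // -exprMn.
  have q0 := ltW (qexp_gt0 hq n); have d0 := normr_ge0 d.
  apply: lerXn2r; rewrite ?nnegrE.
  - by rewrite !mulr_ge0 // invr_ge0 ltW.
  - by case/andP: (wz n).
  - rewrite mul1r ler_pdivrMr // mulrA divfK // mulrDr mulr1 mulrC lerDl //.
have cu n : series (u n) @ \oo --> limn (series (u n)).
  by apply: (geom_bounded_is_cvg (wz n)); exists (C * C').
pose f n := limn (series (u n)).
have rec n : (1 - a * d * q ^+ n) * f n = (1 - d * q ^+ n) * f n.+1.
  apply/eqP; rewrite -subr_eq0; apply/eqP.
  have h1 := cvg_seriesB (cvg_seriesZ (c := 1 - a * d * q ^+ n) (cu n))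
    (cvg_seriesZ (c := 1 - d * q ^+ n) (cu n.+1)).
  apply: (cvg_series_unique h1).
  (* A common form for both series: denominators taken at d q^(n+1), powers at d q^n. Then (1 - a d
     q^n) [u n m] is v m times 1 - a d q^(n+m), and [u n.+1 m] is v m times q^m. *)
  pose v m := qp a m / (qp (a * (d * q ^+ n.+1)) m * qp q m) *
    ((- (d * q ^+ n)) ^+ m * q ^+ 'C(m, 2)).
  (* G telescopes the contiguous relation (1 - a d) f(d) = (1 - d) f(d q). *)
  pose G m := - (v m * ((1 - q ^+ m) * (1 - a * d * q ^+ n * q ^+ m))).
  have vE m : v m.+1 * ((1 - q ^+ m.+1) * (1 - a * d * q ^+ n * q ^+ m.+1)) =
      - (v m * ((1 - a * q ^+ m) * (d * q ^+ n * q ^+ m))).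
    rewrite /v !qpochS binS bin1 exprD.
    have h2 : 1 - a * (d * q ^+ n.+1) * q ^+ m != 0 by apply: qfactor_neq0.
    have h4 := nz n.+1 m.
    rewrite (_ : a * d * q ^+ n * q ^+ m.+1 = a * (d * q ^+ n.+1) * q ^+ m); last first.
      by rewrite !exprS; ring.
    rewrite -(exprS q m) [(- (d * q ^+ n)) ^+ m.+1]exprS.
    have h3 := qexpS_neq1 hq m.
    by field; rewrite h2 h3 h4 qf_neq0.
  have uE m : (1 - a * d * q ^+ n) * u n m = v m * (1 - a * d * q ^+ n * q ^+ m).
    have : (1 - a * d * q ^+ n) * qp (a * (d * q ^+ n.+1)) m =
        qp (a * (d * q ^+ n)) m * (1 - a * d * q ^+ n * q ^+ m).
      have -> : a * (d * q ^+ n.+1) = a * (d * q ^+ n) * q by rewrite exprS; ring.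
      have -> : a * d * q ^+ n = a * (d * q ^+ n) by ring.
      by rewrite -qpochSl qpochS.
    move=> e; rewrite /u /v.
    apply: (mulfI (nz n.+1 m)); apply: (mulfI (nz n m)).
    transitivity (((1 - a * d * q ^+ n) * qp (a * (d * q ^+ n.+1)) m) *
      (qp a m / qp q m * ((- (d * q ^+ n)) ^+ m * q ^+ 'C(m, 2)))).
      by field; rewrite nz qf_neq0.
    by rewrite e; field; rewrite nz qf_neq0.
  apply: (@eq_cvg_series _ (fun m => G m.+1 - G m)).
    move=> m; rewrite /G vE.
    have uS : u n.+1 m = v m * q ^+ m.
      rewrite /u /v (_ : - (d * q ^+ n.+1) = - (d * q ^+ n) * q); last by rewrite exprS; ring.
      by rewrite (exprMn m (- (d * q ^+ n)) q) !mulrA; ring.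
    by rewrite uE uS; ring.
  apply: cvg_series_telescope; first by rewrite /G expr0 subrr mul0r mulr0 oppr0.
  apply: (geom_bounded_cvg0 (wz n)); exists (`|1 - a * d * q ^+ n| * (C * C')) => m.
  rewrite (_ : G m = - ((1 - a * d * q ^+ n) * u n m * (1 - q ^+ m))); last first.
    by rewrite uE /G; ring.
  rewrite normrN; apply: (@le_trans _ _ `|(1 - a * d * q ^+ n) * u n m|).
    rewrite normrM ler_piMr // ger0_norm; first by rewrite gerBl ltW // (qexp_gt0 hq).
    by rewrite subr_ge0 (qexp_le1 hq).
  by rewrite normrM -[leRHS]mulrA ler_wpM2l.
have fE n : qp (a * d) n * f 0%N = qp d n * f n.
  elim: n => [|n IH]; first by rewrite !qpoch0.
  by rewrite !qpochS mulrAC IH -[RHS]mulrA -rec; ring.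
have f1 : f @ \oo --> (1 : R).
  rewrite (_ : f = fun n => 1 + (f n - 1)); last by apply/funext => n; rewrite addrC subrK.
  rewrite -[X in _ --> X]addr0; apply: cvgD; first exact: cvg_cst.
  apply: (@geom_bounded_cvg0 _ _ q); first by rewrite ltW.
  exists (C * C') => n; have [w0 w1] := andP (wz n).
  have := geom_series_tail_le 1 (wz n) (ub n).
  rewrite {2}/series /= big_nat1 /u !qpoch0 !expr0 mulr1 invr1 !mulr1 -/(f n) expr1.
  move=> /le_trans; apply; rewrite -mulrA ler_wpM2l ?mulr_ge0 //.
  rewrite ler_pdivrMr; last by lra.
  have := qexp_gt0 hq n; have := qexp_le1 hq n; nra.
have lim1 : (fun n => qp (a * d) n * f 0%N) @ \oo --> qi (a * d) * f 0%N.
  by apply: cvgMl; apply: cvg_qpoch.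
have lim2 : (fun n => qp (a * d) n * f 0%N) @ \oo --> qi d * 1.
  rewrite (_ : (fun n => _) = fun n => qp d n * f n); last exact/funext/fE.
  by apply: cvgM => //; apply: cvg_qpoch.
have e : qi (a * d) * f 0%N = qi d by rewrite (cvg_unique _ lim1 lim2) // mulr1.
have ad1 : a * d < 1 by rewrite (le_lt_trans ad0).
rewrite -e mulrAC mulfV ?qpoch_inf_neq0 // mul1r.
by apply: (eq_cvg_series _ (cu 0%N)) => m; rewrite /u expr0 mulr1.
Qed.

(* Both series come from one double series, summed by columns with the
   q-binomial theorem and along diagonals with the q-Vandermonde sum. *)
Lemma qphi21_jackson a b e z : 0 <= z < 1 -> a * z < 1 -> b * e < 1 -> exists L : R,
  series (fun k => qp e k * qp a k / (qp (b * e) k * qp (a * z) k * qp q k) *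
    ((- (b * z)) ^+ k * q ^+ 'C(k, 2))) @ \oo --> qi z / qi (a * z) * L /\
  series (fun n => qp a n * qp b n / (qp (b * e) n * qp q n) * z ^+ n) @ \oo --> L.
Proof.
move=> hz az be; have [z0 z1] := andP hz.
pose T m k := qp e k / (qp (b * e) k * qp q k) * ((- b) ^+ k * q ^+ 'C(k, 2)) * z ^+ k *
  qp a k * (qp (a * q ^+ k) m / qp q m * z ^+ m).
have ben k : qp (b * e) k != 0 by apply: qpoch_neq0.
have azn k : qp (a * z) k != 0 by apply: qpoch_neq0.
have [C hC] : exists C, forall m k, `|T m k| <= C * z ^+ (m + k).
  have h1 : geom_bounded (fun k => q ^+ 'C(k, 2) * (- b) ^+ k *
      (qp e k * (qp (b * e) k)^-1 * (qp q k)^-1)) 1.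
    have rp : rapid (fun k => q ^+ 'C(k, 2) * (- b) ^+ k).
      have b1 : 0 < `|b| + 1 by rewrite ltr_wpDl.
      apply: (rapidMgeom b1 (rapid_qbin hq)).
      by apply: geom_bounded_le (geom_bounded_exp _); rewrite ?normrN // lerDl.
    have gb : geom_bounded (fun k => qp e k * (qp (b * e) k)^-1 * (qp q k)^-1) 1.
      have := geom_boundedM (geom_boundedM (qpoch_geom_bounded hq e)
        (qpochV_geom_bounded hq be)) (qpochV_geom_bounded hq q_lt1).
      by rewrite !mulr1.
    exact: (rapidMbounded rp gb ltr01).
  have [C1 C10 hC1] := geom_bounded_ge0 h1.
  have [C2 C20 hC2] := geom_bounded_ge0 (qpoch_geom_bounded hq a).
  have [C3 C30 hC3] := geom_bounded_ge0 (qpochV_geom_bounded hq q_lt1).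
  exists (C1 * (C2 * C3)) => m k.
  have -> : T m k = q ^+ 'C(k, 2) * (- b) ^+ k *
      (qp e k * (qp (b * e) k)^-1 * (qp q k)^-1) * (qp a (k + m) / qp q m) * z ^+ (m + k).
    by rewrite /T qpochD exprD invfM; ring.
  rewrite normrM (ger0_norm (exprn_ge0 _ z0)) ler_wpM2r ?exprn_ge0 //.
  rewrite normrM ler_pM //; first by have := hC1 k; rewrite expr1n mulr1.
  rewrite normrM ler_pM //; first by have := hC2 (k + m)%N; rewrite expr1n mulr1.
  by have := hC3 m; rewrite expr1n mulr1.
have [L [h1 h2]] := cvg_series_diagonal hz hC.
have inz : qi z != 0 by apply: qpoch_inf_neq0.
have inaz : qi (a * z) != 0 by apply: qpoch_inf_neq0.
exists L; split.
- apply: (eq_cvg_series _ (cvg_seriesZ (c := qi z / qi (a * z)) h1)) => k.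
  have col : series (T^~ k) @ \oo --> qp e k / (qp (b * e) k * qp q k) *
      ((- b) ^+ k * q ^+ 'C(k, 2)) * z ^+ k * qp a k * (qi (a * q ^+ k * z) / qi z).
    by apply: cvg_seriesZ; apply: qbinomial.
  rewrite (cvg_lim _ col) //.
  rewrite (qpoch_infD hq (a * z) k) (_ : a * q ^+ k * z = a * z * q ^+ k); last by ring.
  have inaz' : qi (a * z * q ^+ k) != 0.
    by apply: qpoch_inf_neq0 => //; apply: mul_qexp_lt1.
  rewrite -mulNr (exprMn k (- b) z).
  by field; rewrite inz inaz' azn ben qf_neq0.
- apply: (eq_cvg_series _ h2) => n.
  have := qVandermonde_rev hq e b n; rewrite (mulrC e b) => hV.
  transitivity (qp a n / qp (b * e) n * z ^+ n * (qp b n / qp q n)); last first.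
    by field; rewrite ben qf_neq0.
  rewrite -hV mulr_sumr; apply: eq_bigr => k _.
  rewrite /T; have kn : (k <= n)%N by rewrite -ltnS.
  have -> : qp a n = qp a k * qp (a * q ^+ k) (n - k) by rewrite -qpochD subnKC.
  have E : qp (b * e) n = qp (b * e) k * qp (b * e * q ^+ k) (n - k) by rewrite -qpochD subnKC.
  have -> : z ^+ n = z ^+ k * z ^+ (n - k) by rewrite -exprD subnKC.
  rewrite E; have ben' : qp (b * e * q ^+ k) (n - k) != 0.
    by apply: qpoch_neq0 => //; apply: mul_qexp_lt1.
  by field; rewrite ben ben' !qf_neq0.
Qed.
End Transformations.

(** * The symmetric kernel and its dual difference operator *)

(** G(x - 1) with the convention G(-1) = 0. The convention matters for [downc], which need not
    vanish at q^0 = 1; it reflects a weight that is 0 at -1. *)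
Definition lag (R : nmodType) (G : nat -> R) (x : nat) : R :=
  if x is x'.+1 then G x' else 0.

Section Kernel.
Variables (R : realType) (q a1 b1 a2 d : R).
Hypothesis hq : 0 < q < 1.
Hypotheses (ha1 : 0 < a1 < 1) (hb1 : 0 < b1 < 1) (ha2 : 0 < a2 < 1) (hd : d < 0).
Implicit Types (a : R) (i j m n x y : nat).

Local Notation qp := (qpoch q).
Local Notation qi := (qpoch_inf q).

Let q_gt0 : 0 < q. Proof. by case/andP: hq. Qed.
Let q_lt1 : q < 1. Proof. by case/andP: hq. Qed.
Let q_neq0 : q != 0. Proof. by rewrite gt_eqF. Qed.
Let qf_neq0 n : qp q n != 0. Proof. exact: qfact_neq0. Qed.
Let a1_neq0 : a1 != 0. Proof. by case/andP: ha1 => h _; rewrite gt_eqF. Qed.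
Let b1_neq0 : b1 != 0. Proof. by case/andP: hb1 => h _; rewrite gt_eqF. Qed.
Let d_neq0 : d != 0. Proof. by rewrite lt_eqF. Qed.
Let a2d_lt1 : a2 * d < 1.
Proof. by case/andP: ha2 => h _; rewrite (@lt_trans _ _ 0) // pmulr_rlt0. Qed.
Let b1a2_lt1 : b1 * a2 < 1.
Proof. by case/andP: ha2 => h h'; case/andP: hb1 => k k'; rewrite mulr_ilt1 // ltW. Qed.

(* The value 0 for m < n makes the recurrences below hold without side
   conditions, and turns the bounds on z1 and z2 into support conditions. *)
Definition wt a m n : R := if (n <= m)%N then qp a (m - n) / qp q (m - n) else 0.

Lemma wtSS a m n : wt a m.+1 n.+1 = wt a m n.
Proof. by rewrite /wt ltnS subSS. Qed.

Lemma wt_gt a m n : (m < n)%N -> wt a m n = 0.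
Proof. by rewrite /wt ltnNge; case: leqP. Qed.

Lemma wt_rec a m n :
  (q ^+ n - q * q ^+ m) * wt a m.+1 n = (q ^+ n - a * q ^+ m) * wt a m n.
Proof.
rewrite /wt; have [mn|mn|->] := ltngtP n m.+1.
- have le_nm : (n <= m)%N by rewrite -ltnS.
  rewrite le_nm (subSn le_nm) !qpochS.
  have -> : q ^+ m = q ^+ n * q ^+ (m - n) by rewrite -exprD subnKC.
  have := qexpS_neq1 hq (m - n); rewrite exprS => h.
  by field; rewrite h qf_neq0.
- by rewrite leqNgt (ltnW mn) /= !mulr0.
(* The critical case n = m + 1: the weight jumps from 0 to 1, and the factor q^n - q^(m+1)
   vanishes. *)
- by rewrite ltnn mulr0 exprS subrr mul0r.
Qed.

Lemma wt_recP a m n :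
  (q * q ^+ n - q * q ^+ m) * wt a m n = (q * q ^+ n - a * q ^+ m) * wt a m n.+1.
Proof. by rewrite -wtSS -exprS wt_rec. Qed.

(* With i = z1, j = z2, the summand of K(x, y) pi(y) is, up to a constant,
   b1 ^- x * b1 ^- y * (rho i j * (cz x i j * cz y i j)). *)
Definition cz x i j : R := wt b1 x j * wt a2 i x.

Definition rho i j : R :=
  qp a1 j / qp q j * a1 ^- j * ((- (b1 * d)) ^+ i * q ^+ 'C(i, 2) / qp (a2 * d) i) *
  (qp q (i - j) / qp (b1 * a2) (i - j)).

(* The q-Meixner difference operator H, conjugated by pi(x) b1^x. *)
Definition upc (X : R) := (1 - q * X) * (1 - d * X) / b1.
Definition downc (X : R) := - (d / (a1 * q) * X * (1 - a1 * b1 * X / q)).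
Definition diagc (X : R) := - (d / (a1 * b1) * X * (1 - a1 * b1 * X)) + (1 - X) * (1 - d * X / q).

(* H acting on cz in the variable x equals an operator in (i, j), with U = q^i
   and V = q^j: p0 is its diagonal, and p1, ..., p6 multiply the shifts of
   (i, j) by (1,0), (-1,0), (0,1), (0,-1), (1,1), (-1,-1). The first four
   shifts would suffice by partial fractions in q^x, but the diagonal shifts
   are needed to make the operator self-adjoint with respect to rho. *)
Definition p0 (U V : R) : R :=
  d / (b1 * q) * V * (1 - V) + U + d * U * V / b1 - d * a2 * U ^+ 2 / q - d * a2 * U ^+ 2
  + d / (a1 * b1) * V * (1 - a1 * V) + d * a2 / q * U * V - 1.
Definition p1 (U V : R) : R := - (d * U * (V - q * U)).
Definition p2 (U V : R) : R := (1 - d * a2 * U / q) * (V - b1 * a2 * U / q) / b1.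
Definition p3 (U V : R) : R := - (d / (a1 * b1) * (1 - a1 * V) * (V - a2 * b1 * U / q)).
Definition p4 (U V : R) : R := - (d / (q * b1) * (1 - V) * (V - q * U)).
Definition p5 (U V : R) : R := - (d / a1 * U * (1 - a1 * V)).
Definition p6 (U V : R) : R := (1 - d * a2 * U / q) * (1 - V) / b1.

Definition Hx x i j :=
  upc (q ^+ x) * cz x.+1 i j + downc (q ^+ x) * lag (fun x' => cz x' i j) x
  - diagc (q ^+ x) * cz x i j.

(** The weights depend on differences only, so lowering x amounts to raising both i and j. At x = 0
    the weight at j + 1 > 0 is 0, in accordance with [lag]. *)
Lemma lag_cz x i j : lag (fun x' => cz x' i j) x = wt b1 x j.+1 * wt a2 i.+1 x.
Proof. by case: x => [|x] /=; rewrite ?wtSS // wt_gt // mul0r. Qed.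

(* By wtSS, wt a2 i x.+1 is the weight at i - 1, and wt b1 x.+1 j the one at j - 1. *)
Lemma Hx_intertwine x i j : let U := q ^+ i in let V := q ^+ j in
  Hx x i j = p0 U V * cz x i j
  + p1 U V * cz x i.+1 j + p2 U V * (wt b1 x j * wt a2 i x.+1)
  + p3 U V * cz x i j.+1 + p4 U V * (wt b1 x.+1 j * wt a2 i x)
  + p5 U V * cz x i.+1 j.+1 + p6 U V * (wt b1 x.+1 j * wt a2 i x.+1).
Proof.
move=> U V; rewrite /Hx lag_cz /cz; set X := q ^+ x.
have := wt_rec b1 x j; have := wt_recP b1 x j.
have := wt_rec a2 i x; have := wt_recP a2 i x.
rewrite -/U -/V -/X.
move: (wt b1 x j) (wt b1 x.+1 j) (wt b1 x j.+1) => B0 Bp Bm.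
move: (wt a2 i x) (wt a2 i.+1 x) (wt a2 i x.+1) => D0 Dp Dm s1 s2 r1 r2.
apply/eqP; rewrite -subr_eq0; apply/eqP.
(* The identity lies in the ideal of the four recurrences r1, r2, s1, s2. *)
transitivity (
  ((1 - d * X) / b1 * Dm + d / (q * b1) * (1 - V) * D0) *
    ((V - q * X) * Bp - (V - b1 * X) * B0)
  + (- (d / (q * b1) * (1 - V)) * Bp
     + (- b1 - d * V + d * b1 * (X + a2 * U / q)) / (b1 * q) * B0) *
    ((q * X - a2 * U) * Dm - (q * X - q * U) * D0)
  + (- (d / (a1 * q) * (1 - a1 * b1 * X / q)) * Bm + d * U * B0) *
    ((X - q * U) * Dp - (X - a2 * U) * D0)
  + (- (d / q * U) * Dp
     + d / (a1 * b1 * q) * (1 - a1 * V - a1 * b1 * X / q + a1 * b1 * a2 * U / q) * D0) *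
    ((q * V - b1 * X) * Bm - (q * V - q * X) * B0)); last first.
  by rewrite -s1 s2 -r1 r2 !subrr !mulr0 !addr0.
rewrite /upc /downc /diagc /p0 /p1 /p2 /p3 /p4 /p5 /p6.
by field; rewrite a1_neq0 b1_neq0 q_neq0.
Qed.

Let a2dn n : qp (a2 * d) n != 0. Proof. exact: qpoch_neq0. Qed.
Let b1a2n n : qp (b1 * a2) n != 0. Proof. exact: qpoch_neq0. Qed.

(** Self-adjointness with respect to rho reduces to three detailed balance relations on the support
    j <= i, one for each pair of opposite shifts. In [rho_p3] the target (i, j + 1) must stay in the
    support, whence j < i there. *)
Lemma rho_p1 i j : (j <= i)%N ->
  rho i j * p1 (q ^+ i) (q ^+ j) = rho i.+1 j * p2 (q ^+ i.+1) (q ^+ j).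
Proof.
move=> ji; rewrite /rho /p1 /p2 (subSn ji) !qpochS binS bin1 exprD !(exprS _ i).
have E : q ^+ i = q ^+ j * q ^+ (i - j) by rewrite -exprD subnKC.
have h1 : 1 - a2 * d * q ^+ i != 0 by apply: qfactor_neq0.
have h2 : 1 - b1 * a2 * q ^+ (i - j) != 0 by apply: qfactor_neq0.
rewrite E in h1 *; move: (a2dn i) (b1a2n (i - j)) => h3 h4.
by field; rewrite ?h1 ?h2 ?h3 ?h4 ?qf_neq0 ?b1_neq0 ?q_neq0 ?a1_neq0 ?expf_neq0 //=.
Qed.

Lemma rho_p3 i j : (j < i)%N ->
  rho i j * p3 (q ^+ i) (q ^+ j) = rho i j.+1 * p4 (q ^+ i) (q ^+ j.+1).
Proof.
move=> ji; rewrite /rho /p3 /p4 -[in qp q (i - j)](subnSK ji).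
rewrite -[in qp (b1 * a2) (i - j)](subnSK ji) !qpochS !(exprS _ j).
have E : q ^+ i = q * q ^+ j * q ^+ (i - j.+1) by rewrite -exprS -exprD subnKC.
have h2 : 1 - b1 * a2 * q ^+ (i - j.+1) != 0 by apply: qfactor_neq0.
have h5 := qexpS_neq1 hq j; have h6 := qexpS_neq1 hq (i - j.+1).
move: h5 h6; rewrite !exprS => h5 h6.
rewrite E; move: (a2dn i) (b1a2n (i - j.+1)) => h3 h4.
by field; rewrite h2 h3 h4 h5 ?h6 !qf_neq0 b1_neq0 q_neq0 a1_neq0 !expf_neq0.
Qed.

Lemma rho_p5 i j : (j <= i)%N ->
  rho i j * p5 (q ^+ i) (q ^+ j) = rho i.+1 j.+1 * p6 (q ^+ i.+1) (q ^+ j.+1).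
Proof.
move=> ji; rewrite /rho /p5 /p6 subSS !qpochS binS bin1 exprD !(exprS _ i) !(exprS _ j).
have h1 : 1 - a2 * d * q ^+ i != 0 by apply: qfactor_neq0.
have h5 := qexpS_neq1 hq j; rewrite exprS in h5.
move: (a2dn i) (b1a2n (i - j)) => h3 h4.
by field; rewrite h1 h3 h4 h5 !qf_neq0 b1_neq0 q_neq0 a1_neq0 !expf_neq0.
Qed.

(** Summation by parts for one pair of opposite shifts: detailed balance and antisymmetry in x and y
    make t at i + 1 cancel s at i. *)
Lemma sum_antisym_telescope (s t : nat -> R) N : t 0%N = 0 -> (forall i, t i.+1 = - s i) ->
  \sum_(i < N.+1) (s i + t i) = s N.
Proof.
move=> t0 tS; elim: N => [|N IH]; first by rewrite big_ord_recr big_ord0 /= t0 addr0 add0r.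
by rewrite big_ord_recr /= IH tS; ring.
Qed.

(* What remains at z1 = i after summation by parts; it vanishes as i -> oo. *)
Definition bdry x y i j : R :=
  rho i j * p1 (q ^+ i) (q ^+ j) * (cz x i.+1 j * cz y i j - cz x i j * cz y i.+1 j)
  + rho i j * p5 (q ^+ i) (q ^+ j) *
    (cz x i.+1 j.+1 * cz y i j - cz x i j * cz y i.+1 j.+1).

Lemma cz_gt_i x i j : (i < x)%N -> cz x i j = 0.
Proof. by move=> h; rewrite /cz (wt_gt a2) // mulr0. Qed.

Lemma cz_gt_j x i j : (x < j)%N -> cz x i j = 0.
Proof. by move=> h; rewrite /cz wt_gt // mul0r. Qed.

Lemma cz_gt_ij x i j : (i < j)%N -> cz x i j = 0.
Proof.
move=> ij; have [ix|xi] := ltnP i x; first exact: cz_gt_i.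
by rewrite cz_gt_j // (leq_ltn_trans xi).
Qed.

(** The diagonal p0 cancels by antisymmetry, and the six shifts cancel in pairs. In j nothing is
    left over, as [cz x i j] vanishes for j > x; in i the terms at the cut-off N remain. The range
    M.+2 leaves room for the index x + 1 in [cvg_Hcore]. *)
Lemma Hx_antisym x y N M : (x <= M)%N -> (y <= M)%N ->
  \sum_(i < N.+1) \sum_(j < M.+2) rho i j * (Hx x i j * cz y i j - cz x i j * Hx y i j) =
  \sum_(j < M.+2) bdry x y N j.
Proof.
move=> xM yM.
pose cm x i j := wt b1 x j * wt a2 i x.+1.
pose cp x i j := wt b1 x.+1 j * wt a2 i x.
pose cpm x i j := wt b1 x.+1 j * wt a2 i x.+1.
have cmS z i j : cm z i.+1 j = cz z i j by rewrite /cm wtSS.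
have cm0 z j : cm z 0%N j = 0 by rewrite /cm (wt_gt a2) // mulr0.
have cpS z i j : cp z i j.+1 = cz z i j by rewrite /cp wtSS.
have cpmS z i j : cpm z i.+1 j.+1 = cz z i j by rewrite /cpm !wtSS.
have cpm0 z j : cpm z 0%N j = 0 by rewrite /cpm (wt_gt a2) // mulr0.
pose sA i j := rho i j * p1 (q ^+ i) (q ^+ j) * (cz x i.+1 j * cz y i j - cz x i j * cz y i.+1 j).
pose tA i j := rho i j * p2 (q ^+ i) (q ^+ j) * (cm x i j * cz y i j - cz x i j * cm y i j).
pose sB i j := rho i j * p3 (q ^+ i) (q ^+ j) * (cz x i j.+1 * cz y i j - cz x i j * cz y i j.+1).
pose tB i j := rho i j * p4 (q ^+ i) (q ^+ j) * (cp x i j * cz y i j - cz x i j * cp y i j).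
pose sC i j := rho i j * p5 (q ^+ i) (q ^+ j) *
  (cz x i.+1 j.+1 * cz y i j - cz x i j * cz y i.+1 j.+1).
pose tC i j := rho i j * p6 (q ^+ i) (q ^+ j) * (cpm x i j * cz y i j - cz x i j * cpm y i j).
have splitD (i j : nat) : rho i j * (Hx x i j * cz y i j - cz x i j * Hx y i j) =
    (sA i j + tA i j) + (sB i j + tB i j) + (sC i j + tC i j).
  rewrite !Hx_intertwine /sA /tA /sB /tB /sC /tC -/(cm x i j) -/(cm y i j) -/(cp x i j)
    -/(cp y i j) -/(cpm x i j) -/(cpm y i j).
  move: (cz x) (cz y) (cm x i j) (cm y i j) (cp x i j) (cp y i j) (cpm x i j) (cpm y i j).
  by move=> *; ring.
have tA0 j : tA 0%N j = 0 by rewrite /tA !cm0 mul0r mulr0 subrr mulr0.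
have tAS i j : tA i.+1 j = - sA i j.
  rewrite /tA /sA !cmS; have [ji|ij] := leqP j i; first by rewrite -rho_p1 //; ring.
  by rewrite !(cz_gt_ij _ ij) !(mulr0, mul0r) subrr !mulr0 oppr0.
have tB0 i : tB i 0%N = 0 by rewrite /tB /p4 expr0 subrr mulr0 mul0r oppr0 mulr0 mul0r.
have tBS i j : tB i j.+1 = - sB i j.
  rewrite /tB /sB !cpS; have [ji|ij] := ltnP j i; first by rewrite rho_p3 //; ring.
  by rewrite !(@cz_gt_ij _ i j.+1) // !(mulr0, mul0r) subrr !mulr0 oppr0.
have tCS i j : tC i.+1 j.+1 = - sC i j.
  rewrite /tC /sC !cpmS; have [ji|ij] := leqP j i; first by rewrite rho_p5 //; ring.
  by rewrite !(cz_gt_ij _ ij) !(mulr0, mul0r) subrr !mulr0 oppr0.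
have tC0 j : tC 0%N j = 0 by rewrite /tC !cpm0 mul0r mulr0 subrr mulr0.
have tCj0 i : tC i 0%N = 0 by rewrite /tC /p6 expr0 subrr mulr0 mul0r mulr0 mul0r.
have sBM i : sB i M.+1 = 0.
  by rewrite /sB !(@cz_gt_j _ i M.+2) ?ltnS ?(leqW xM) ?(leqW yM) // mul0r mulr0 subrr mulr0.
have sCM i : sC i M.+1 = 0.
  by rewrite /sC !(@cz_gt_j _ i.+1 M.+2) ?ltnS ?(leqW xM) ?(leqW yM) // mul0r mulr0 subrr mulr0.
under eq_bigr => i _ do under eq_bigr => j _ do rewrite splitD.
under eq_bigr => i _ do rewrite !big_split /=.
rewrite !big_split /=.
have -> : \sum_(i < N.+1) \sum_(j < M.+2) sA i j + \sum_(i < N.+1) \sum_(j < M.+2) tA i j =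
    \sum_(j < M.+2) sA N j.
  rewrite exchange_big [X in _ + X]exchange_big -big_split /=; apply: eq_bigr => j _.
  by rewrite -big_split /= (@sum_antisym_telescope (sA^~ j) (tA^~ j)).
have -> : \sum_(i < N.+1) \sum_(j < M.+2) sB i j + \sum_(i < N.+1) \sum_(j < M.+2) tB i j = 0.
  rewrite -big_split /= big1 // => i _.
  by rewrite -big_split /= (@sum_antisym_telescope (sB i) (tB i)).
have -> : \sum_(i < N.+1) \sum_(j < M.+2) sC i j + \sum_(i < N.+1) \sum_(j < M.+2) tC i j =
    \sum_(j < M.+2) sC N j.
  (* Along diagonals tC at (i + 1, j + 1) cancels sC at (i, j); the row 0 and column 0 of tC and the
     last column of sC vanish, so only the row N of sC survives. *)
  rewrite big_ord_recr /= [X in _ + X]big_ord_recl /=.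
  rewrite [X in _ + (X + _)]big1 // add0r addrAC -big_split /= big1 ?add0r // => i _.
  rewrite big_ord_recr /= sCM addr0 [X in _ + X]big_ord_recl /= tCj0 add0r -big_split /= big1 // => j _.
  by rewrite /bump /= !add1n tCS subrr.
by rewrite addr0 -big_split.
Qed.

Lemma wt_bounded a : a < 1 -> exists2 C : R, 0 <= C & forall m n, `|wt a m n| <= C.
Proof.
move=> a1'; have := geom_boundedM (qpoch_geom_bounded hq a) (qpochV_geom_bounded hq q_lt1).
rewrite mul1r => /geom_bounded_ge0[C C0 hC]; exists C => // m n.
rewrite /wt; case: leqP => _; last by rewrite normr0.
by have := hC (m - n)%N; rewrite expr1n mulr1.
Qed.

Lemma geom_bounded_comp (f : nat -> R) (g : nat -> nat) :
  geom_bounded f 1 -> geom_bounded (fun n => f (g n)) 1.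
Proof. by case=> C hC; exists C => n; have := hC (g n); rewrite !expr1n. Qed.

Lemma rho_rapid j : rapid (rho^~ j).
Proof.
have e0 : 0 < `|- (b1 * d)| by rewrite normr_gt0 oppr_eq0 mulf_neq0.
have g1 : geom_bounded (fun i => (qp (a2 * d) i)^-1) 1 by apply: qpochV_geom_bounded.
have g2 : geom_bounded (fun i => qp q (i - j)) 1.
  by apply: (@geom_bounded_comp (qp q) (fun i => i - j)%N); apply: qpoch_geom_bounded.
have g3 : geom_bounded (fun i => (qp (b1 * a2) (i - j))^-1) 1.
  apply: (@geom_bounded_comp (fun n => (qp (b1 * a2) n)^-1) (fun i => i - j)%N).
  exact: qpochV_geom_bounded.
have := rapidMbounded (rapidMbounded (rapidMbounded (rapidMbounded (rapidMgeom e0 (rapid_qbin hq)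
   (geom_bounded_exp _)) g1) g2) g3) (geom_bounded_cst (qp a1 j / qp q j * a1 ^- j)).
by apply: eq_rapid => i; rewrite /rho; ring.
Qed.

Lemma cz_bounded : exists2 C : R, 0 <= C & forall x i j, `|cz x i j| <= C.
Proof.
have [C C0 hC] := @wt_bounded b1 ltac:(by case/andP: hb1).
have [D D0 hD] := @wt_bounded a2 ltac:(by case/andP: ha2).
exists (C * D); first exact: mulr_ge0.
by move=> x i j; rewrite /cz normrM ler_pM.
Qed.

Lemma cz_geom_bounded (g h : nat -> nat) x : geom_bounded (fun i => cz x (g i) (h i)) 1.
Proof.
by have [C _ hC] := cz_bounded; exists C => n; rewrite expr1n mulr1.
Qed.

Definition coreterm x y i : R := \sum_(j < x.+1) rho i j * (cz x i j * cz y i j).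

Definition core x y : R := limn (series (coreterm x y)).

(** Terms with j > x vanish, so the bound can be enlarged at will; with a common bound for both
    arguments the symmetry becomes visible. *)
Lemma coretermE x y i M : (x < M)%N ->
  coreterm x y i = \sum_(j < M) rho i j * (cz x i j * cz y i j).
Proof.
move=> xM; rewrite -(subnKC xM) big_split_ord /= [X in _ + X]big1 ?addr0 //.
by move=> j _; rewrite cz_gt_j ?mul0r ?mulr0 // leq_addr.
Qed.

Lemma coreterm_sym x y i : coreterm x y i = coreterm y x i.
Proof.
rewrite (@coretermE x y i (x + y).+1) ?ltnS ?leq_addr //.
rewrite (@coretermE y x i (x + y).+1) ?ltnS ?leq_addl //.
by apply: eq_bigr => j _; rewrite (mulrC (cz x i j)).
Qed.

Lemma core_sym x y : core x y = core y x.
Proof. by congr (limn (series _)); apply/funext => i; apply: coreterm_sym. Qed.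

Lemma coreterm_lt x y i : (i < y)%N -> coreterm x y i = 0.
Proof. by move=> iy; rewrite /coreterm big1 // => j _; rewrite (cz_gt_i _ iy) !mulr0. Qed.

(** Uniformity in y is the point: since the series starts only at i = y, a uniform bound in i
    becomes decay of [core x y] in y. *)
Lemma coreterm_bound x r : 0 < r ->
  exists2 C : R, 0 <= C & forall y i, `|coreterm x y i| <= C * r ^+ i.
Proof.
move=> r0; have [D D0 hD] := cz_bounded.
have [C C0 hC] : exists2 C : R, 0 <= C & forall i, \sum_(j < x.+1) `|rho i j| <= C * r ^+ i.
  elim: x.+1 => [|k [C C0 hC]]; first by exists 0 => // i; rewrite big_ord0 mul0r.
  have [C' C'0 hC'] := geom_bounded_ge0 (rho_rapid k r0).
  exists (C + C') => [|i]; first exact: addr_ge0.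
  by rewrite big_ord_recr /= mulrDl lerD.
exists (C * (D * D)) => [|y i]; first by rewrite !mulr_ge0.
rewrite mulrAC (le_trans (ler_norm_sum _ _ _)) //.
apply: (@le_trans _ _ (\sum_(j < x.+1) `|rho i j| * (D * D))).
  by apply: ler_sum => j _; rewrite normrM ler_wpM2l // normrM ler_pM.
by rewrite -mulr_suml ler_wpM2r // mulr_ge0.
Qed.

Lemma cvg_core x y : series (coreterm x y) @ \oo --> core x y.
Proof.
have h : 0 <= (1 / 2 : R) < 1 by lra.
have [C _ hC] := coreterm_bound x (divr_gt0 (@ltr01 R) (@ltr0Sn R 1)).
by apply: (geom_bounded_is_cvg h); exists C.
Qed.

Lemma core_rapid x : rapid (core x).
Proof.
suff small r : 0 < r < 1 -> geom_bounded (core x) r.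
  move=> r r0; have [r1|r1] := ltrP r 1; first by apply: small; rewrite r0.
  have h : 0 < (1 / 2 : R) < 1 by lra.
  by apply: (geom_bounded_le _ _ (small _ h)); lra.
move=> /andP[r0 r1]; have [C C0 hC] := coreterm_bound x r0.
have hr : 0 <= r < 1 by rewrite ltW.
exists (C / (1 - r)) => y; rewrite mulrAC.
have := geom_series_tail_le y hr (hC y).
rewrite [X in _ - X](_ : _ = 0) ?subr0 // /series /= big_nat big1 // => i /andP[_ iy].
exact: coreterm_lt.
Qed.

Definition Hcore x y : R :=
  upc (q ^+ x) * core x.+1 y + downc (q ^+ x) * lag (core^~ y) x - diagc (q ^+ x) * core x y.

Lemma cvg_Hcore x y :
  series (fun i => \sum_(j < (x + y).+2) rho i j * (Hx x i j * cz y i j)) @ \oo --> Hcore x y.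
Proof.
have h1 := cvg_seriesZ (c := upc (q ^+ x)) (cvg_core (x := x.+1) (y := y)).
have h3 := cvg_seriesZ (c := diagc (q ^+ x)) (cvg_core (x := x) (y := y)).
have h2 : series (fun i => downc (q ^+ x) * lag (fun x' => coreterm x' y i) x) @ \oo -->
    downc (q ^+ x) * lag (core^~ y) x.
  apply: cvg_seriesZ; case: x {h1 h3} => [|x] /=; last exact: cvg_core.
  rewrite (_ : series _ = fun=> 0); first exact: cvg_cst.
  by apply/funext => n; rewrite /series /= big1.
apply: (eq_cvg_series _ (cvg_seriesB (cvg_seriesD h1 h2) h3)) => i.
rewrite (@coretermE x.+1 _ _ (x + y).+2) ?ltnS ?leq_addr //.
rewrite (@coretermE x _ _ (x + y).+2) ?ltnS ?leqW ?leq_addr //.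
have -> : lag (fun x' => coreterm x' y i) x =
    \sum_(j < (x + y).+2) rho i j * (lag (fun x' => cz x' i j) x * cz y i j).
  case: x {h1 h2 h3} => [|x] /=; first by rewrite big1 // => j _; rewrite mul0r mulr0.
  by apply: coretermE; rewrite !ltnS !(leqW, addSn) // ?leq_addr.
rewrite !mulr_sumr -big_split -sumrB /=; apply: eq_bigr => j _.
by rewrite /Hx; ring.
Qed.

Lemma Hcore_sym x y : Hcore x y = Hcore y x.
Proof.
apply/eqP; rewrite -subr_eq0; apply/eqP.
have h := cvg_seriesB (cvg_Hcore (x := x) (y := y)) (cvg_Hcore (x := y) (y := x)).
apply: (cvg_series_unique h).
set u := fun i => _.
have uE N : series u N.+1 = \sum_(j < (x + y).+2) bdry x y N j.
  rewrite -(Hx_antisym N (leq_addr y x) (leq_addl x y)) /series /= big_mkord.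
  apply: eq_bigr => i _; rewrite /u (addnC y) -sumrB; apply: eq_bigr => j _.
  by rewrite -mulrBr (mulrC (Hx y i j)).
rewrite -(cvg_shiftS (series u) (nbhs (0 : R))).
have -> : (fun n => series u n.+1) = (fun N => \sum_(j < (x + y).+2) bdry x y N j).
  exact/funext.
apply: (@geom_bounded_cvg0 _ _ (1 / 2)); first by lra.
apply: rapid_sum; last by lra.
move=> j; rewrite /bdry.
have gU := qexp_bounded hq.
have gp1 : geom_bounded (fun i => p1 (q ^+ i) (q ^+ j)) 1.
  have := geom_bounded1M (geom_bounded1M (geom_bounded_cst (- d)) gU)
    (geom_boundedD (geom_bounded_cst (q ^+ j)) (geom_bounded1M (geom_bounded_cst (- q)) gU)).
  by rewrite /p1; under eq_fun do rewrite !mulNr; exact.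
have gp5 : geom_bounded (fun i => p5 (q ^+ i) (q ^+ j)) 1.
  have := geom_bounded1M (geom_bounded1M (geom_bounded_cst (- (d / a1))) gU) (geom_bounded_cst (1 - a1 * q ^+ j)).
  by rewrite /p5; under eq_fun do rewrite !mulNr; exact.
have cb := cz_geom_bounded.
apply: rapidD; apply: rapidMbounded.
- by apply: rapidMbounded gp1; apply: rho_rapid.
- by apply: geom_boundedB => //; apply: geom_bounded1M;
    [apply: (cb S (fun=> j))|apply: (cb id (fun=> j))|
     apply: (cb id (fun=> j))|apply: (cb S (fun=> j))].
- by apply: rapidMbounded gp5; apply: rho_rapid.
- by apply: geom_boundedB => //; apply: geom_bounded1M;
    [apply: (cb S (fun=> j.+1))|apply: (cb id (fun=> j))|
     apply: (cb id (fun=> j))|apply: (cb S (fun=> j.+1))].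
Qed.
End Kernel.

(** * Eigenfunctions *)

(** With c = beta q and d = - beta gamma q, [birth] and [death] are the rates of the q-Meixner
    difference equation at Y = q^y, and [mweight] is the q-Meixner weight up to a constant. *)
Definition birth (R : realType) (c d Y : R) : R := - (d / c * Y * (1 - c * Y)).
Definition death (R : realType) (q d Y : R) : R := (1 - Y) * (1 - d * Y / q).

Definition meixner_eigen (R : realType) (q c d lam : R) (f : nat -> R) :=
  forall y, birth c d (q ^+ y) * f y.+1 + death q d (q ^+ y) * lag f y
    - (birth c d (q ^+ y) + death q d (q ^+ y)) * f y = lam * f y.

Definition mweight (R : realType) (q c d : R) (x : nat) : R :=
  qpoch q c x / (qpoch q q x * qpoch q d x) * (- (d / c)) ^+ x * q ^+ 'C(x, 2).

Section Eigen.
Variables (R : realType) (q a1 b1 a2 d : R).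
Hypothesis hq : 0 < q < 1.
Hypotheses (ha1 : 0 < a1 < 1) (hb1 : 0 < b1 < 1) (ha2 : 0 < a2 < 1) (hd : d < 0).
Implicit Types (f : nat -> R) (i j m n x y : nat).

Local Notation qp := (qpoch q).
Local Notation core := (core q a1 b1 a2 d).
Local Notation upc := (upc q b1 d).
Local Notation downc := (downc q a1 b1 d).
Local Notation diagc := (diagc q a1 b1 d).

Let q_gt0 : 0 < q. Proof. by case/andP: hq. Qed.
Let q_neq0 : q != 0. Proof. by rewrite gt_eqF. Qed.
Let qf_neq0 n : qp q n != 0. Proof. exact: qfact_neq0. Qed.
Let a1_neq0 : a1 != 0. Proof. by case/andP: ha1 => h _; rewrite gt_eqF. Qed.
Let b1_neq0 : b1 != 0. Proof. by case/andP: hb1 => h _; rewrite gt_eqF. Qed.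
Let qpd n : qp d n != 0. Proof. by apply: qpoch_neq0 => //; rewrite (lt_trans hd). Qed.
Let c := a1 * b1.

Lemma upc_neq0 x : upc (q ^+ x) != 0.
Proof.
rewrite /upc !mulf_neq0 ?invr_eq0 //; first by rewrite -exprS qexpS_neq1.
by apply: qfactor_neq0 => //; rewrite (lt_trans hd).
Qed.

Lemma recurrence_unique (F G : nat -> R) lam :
  (forall x, upc (q ^+ x) * F x.+1 + downc (q ^+ x) * lag F x
    - diagc (q ^+ x) * F x = lam * F x) ->
  (forall x, upc (q ^+ x) * G x.+1 + downc (q ^+ x) * lag G x
    - diagc (q ^+ x) * G x = lam * G x) ->
  F 0%N = 1 -> forall x, G x = G 0%N * F x.
Proof.
move=> hF hG F0 x.
(* The recurrence has order two, so the induction carries the values at x and x - 1 together. *)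
suff : G x = G 0%N * F x /\ lag G x = G 0%N * lag F x by case.
elim: x => [|x [IH1 IH2]]; first by rewrite F0 /= mulr1 mulr0.
split=> //=; apply: (mulfI (upc_neq0 x)).
have -> : upc (q ^+ x) * G x.+1 =
    lam * G x + diagc (q ^+ x) * G x - downc (q ^+ x) * lag G x by rewrite -hG; ring.
rewrite mulrCA; have -> : upc (q ^+ x) * F x.+1 =
    lam * F x + diagc (q ^+ x) * F x - downc (q ^+ x) * lag F x by rewrite -hF; ring.
by rewrite IH1 IH2; ring.
Qed.

(** [upc] is the death rate at x + 1 divided by b1, and for x > 0 [downc] is b1 times the birth rate
    at x - 1. Detailed balance of [mweight] turns them back into the birth and death rates at x. *)
Lemma mweight_recurrence f lam : meixner_eigen q c d lam f ->
  let F x := mweight q c d x * b1 ^+ x * f x in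
  forall x, upc (q ^+ x) * F x.+1 + downc (q ^+ x) * lag F x
    - diagc (q ^+ x) * F x = lam * F x.
Proof.
move=> hf F x; have c0 : c != 0 by rewrite mulf_neq0.
have up z : upc (q ^+ z) * (mweight q c d z.+1 * b1 ^+ z.+1) =
    birth c d (q ^+ z) * (mweight q c d z * b1 ^+ z).
  rewrite /upc /birth /mweight !qpochS binS bin1 exprD !exprS.
  have h1 := qexpS_neq1 hq z; rewrite exprS in h1.
  have h2 : 1 - d * q ^+ z != 0 by apply: qfactor_neq0 => //; rewrite (lt_trans hd).
  by field; rewrite h1 h2 qf_neq0 qpd b1_neq0 c0.
have down : downc (q ^+ x) * lag F x =
    death q d (q ^+ x) * lag f x * (mweight q c d x * b1 ^+ x).
  case: x => [|x] /=; first by rewrite !(mulr0, mul0r).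
  rewrite /F /downc /death /mweight !qpochS binS bin1 exprD !exprS.
  have h1 := qexpS_neq1 hq x; rewrite exprS in h1.
  have h2 : 1 - d * q ^+ x != 0 by apply: qfactor_neq0 => //; rewrite (lt_trans hd).
  by rewrite /c; field; rewrite h1 h2 qf_neq0 qpd b1_neq0 q_neq0 a1_neq0.
rewrite down /F (mulrA (upc (q ^+ x))) up.
have -> : diagc (q ^+ x) = birth c d (q ^+ x) + death q d (q ^+ x) by [].
transitivity (mweight q c d x * b1 ^+ x * (lam * f x)); last by ring.
by rewrite -hf; ring.
Qed.

Lemma core_f_cvg f (s : R) x : 0 < s -> geom_bounded f s ->
  series (fun y => core x y * (b1 ^- y * f y)) @ \oo -->
    limn (series (fun y => core x y * (b1 ^- y * f y))).
Proof.
move=> s0 hf; apply: (@geom_bounded_is_cvg _ _ (1 / 2)); first by lra.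
have hb : 0 < `|b1^-1| * s by rewrite mulr_gt0 // normr_gt0 invr_eq0.
have hg : geom_bounded (fun y => b1 ^- y * f y) (`|b1^-1| * s).
  have := geom_boundedM (geom_bounded_exp (b1^-1)) hf.
  by under eq_fun do rewrite exprVn.
have := rapidMgeom hb (core_rapid a1 hq hb1 ha2 hd x) hg.
by apply; lra.
Qed.

(* By Hcore_sym, the sum over y satisfies in x the same recurrence as
   mweight * b1 ^ x * f, so it suffices to compare the values at 0. *)
Lemma core_eigen f (lam s : R) : 0 < s -> geom_bounded f s -> f 0%N = 1 ->
  meixner_eigen q c d lam f -> forall x,
  series (fun y => core x y * (b1 ^- y * f y)) @ \oo -->
    limn (series (fun y => core 0%N y * (b1 ^- y * f y))) * (mweight q c d x * b1 ^+ x * f x).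
Proof.
move=> s0 hf f0 hH.
pose g y := b1 ^- y * f y; pose G x : R := limn (series (fun y => core x y * g y)).
have cG x : series (fun y => core x y * g y) @ \oo --> G x := core_f_cvg (x := x) s0 hf.
suff GE x : G x = G 0%N * (mweight q c d x * b1 ^+ x * f x).
  by move=> x; rewrite -GE; apply: cG.
apply: (@recurrence_unique (fun x => mweight q c d x * b1 ^+ x * f x) G lam).
- exact: mweight_recurrence.
- move=> {}x; apply/eqP; rewrite -subr_eq0; apply/eqP.
  have h2 : series (fun y => downc (q ^+ x) * (lag (core^~ y) x * g y)) @ \oo -->
      downc (q ^+ x) * lag G x.
    apply: cvg_seriesZ; case: x => [|x] /=; last exact: cG.
    rewrite (_ : series _ = fun=> 0); first exact: cvg_cst.
    by apply/funext => n; rewrite /series /= big1 // => i _; rewrite mul0r.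
  have h := cvg_seriesB (cvg_seriesB (cvg_seriesD (cvg_seriesZ (c := upc (q ^+ x)) (cG x.+1)) h2)
    (cvg_seriesZ (c := diagc (q ^+ x)) (cG x))) (cvg_seriesZ (c := lam) (cG x)).
  apply: (cvg_series_unique h).
  (* The boundary term when the operator, moved to y by [Hcore_sym], is transferred from [core x] to
     f: a Casoratian of [core x] and g between y - 1 and y, equal to 0 at the left end. *)
  pose W' y := if y is y'.+1 then upc (q ^+ y') * core x y * g y' - downc (q ^+ y) * core x y' * g y
    else 0.
  apply: (@eq_cvg_series _ (fun y => W' y.+1 - W' y)).
    move=> y.
    have HS := Hcore_sym hq ha1 hb1 ha2 hd x y; rewrite /Hcore in HS.
    transitivity ((upc (q ^+ x) * core x.+1 y + downc (q ^+ x) * lag (core^~ y) x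
       - diagc (q ^+ x) * core x y) * g y - lam * (core x y * g y)); last by ring.
    rewrite HS (core_sym q a1 b1 a2 d y.+1 x) (core_sym q a1 b1 a2 d y x).
    have -> : lag (core^~ x) y = lag (core x) y.
      by case: y {HS} => [|y] //=; apply: core_sym.
    have -> : lam * (core x y * g y) = core x y * b1 ^- y * (lam * f y) by rewrite /g; ring.
    rewrite -hH.
    have -> : birth c d (q ^+ y) + death q d (q ^+ y) = diagc (q ^+ y) by [].
    have eb : b1 ^- y * birth c d (q ^+ y) * f y.+1 = downc (q ^+ y.+1) * g y.+1.
      rewrite /g /birth /downc /c !exprS.
      by field; rewrite ?expf_neq0 ?a1_neq0 ?b1_neq0 ?q_neq0.
    transitivity ((upc (q ^+ y) * core x y.+1 * g y + downc (q ^+ y) * lag (core x) y * g y)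
      - core x y * (b1 ^- y * birth c d (q ^+ y) * f y.+1
        + b1 ^- y * death q d (q ^+ y) * lag f y)); last by rewrite /g; ring.
    rewrite eb; case: y {HS eb} => [|y] /=; first by rewrite !(mulr0, mul0r, addr0, subr0); ring.
    have ed : b1 ^- y.+1 * death q d (q ^+ y.+1) * f y = upc (q ^+ y) * g y.
      rewrite /g /death /upc !exprS.
      by field; rewrite ?expf_neq0 ?b1_neq0 ?q_neq0.
    by rewrite ed; ring.
  apply: cvg_series_telescope => //.
  rewrite -(cvg_shiftS W' (nbhs (0 : R))) /W'.
  have hb : 0 < `|b1^-1| * s by rewrite mulr_gt0 // normr_gt0 invr_eq0.
  have hg : geom_bounded g (`|b1^-1| * s).
    have := geom_boundedM (geom_bounded_exp (b1^-1)) hf.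
    by under eq_fun do rewrite exprVn.
  have cr := core_rapid a1 hq hb1 ha2 hd x.
  have gU := qexp_bounded hq.
  have gup : geom_bounded (fun y => upc (q ^+ y)) 1.
    have lin e : geom_bounded (fun y => 1 - e * q ^+ y) 1.
      have := geom_boundedD (geom_bounded_cst 1) (geom_bounded1M (geom_bounded_cst (- e)) gU).
      by under eq_fun do rewrite mulNr.
    exact: geom_bounded1M (geom_bounded1M (lin q) (lin d)) (geom_bounded_cst b1^-1).
  have gdown : geom_bounded (fun y => downc (q ^+ y)) 1.
    have lin : geom_bounded (fun y => 1 - a1 * b1 * q ^+ y / q) 1.
      have := geom_boundedD (geom_bounded_cst 1) (geom_bounded1M (geom_bounded1M (geom_bounded_cst (- (a1 * b1))) gU)
        (geom_bounded_cst q^-1)).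
      by under eq_fun do rewrite !mulNr.
    have := geom_bounded1M (geom_bounded1M (geom_bounded_cst (- (d / (a1 * q)))) gU) lin.
    by rewrite /downc; under eq_fun do rewrite !mulNr.
  apply: (@geom_bounded_cvg0 _ _ (1 / 2)); first by lra.
  have r1 := rapidMgeom hb (rapidMbounded (rapidS cr) gup) hg.
  have r2 := rapidMbounded (rapidMgeom hb cr (geom_boundedS (ltW hb) hg))
    (geom_boundedS ler01 gdown).
  have half : 0 < (1 / 2 : R) by lra.
  have [C1 h1] := r1 _ half; have [C2 h2'] := r2 _ half.
  exists (C1 + C2) => y; rewrite mulrDl (le_trans (ler_normB _ _)) // lerD //.
    by rewrite (mulrC (upc _)) h1.
  by rewrite -mulrA mulrC h2'.
- by rewrite /mweight bin_small // !qpoch0 !expr0 f0 !mulr1 divr1.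
Qed.
End Eigen.

Definition mpolycoef (R : realType) (q c d : R) (n k : nat) : R :=
  qpoch q (q ^- n) k / (qpoch q c k * qpoch q q k) * (c / d * q ^+ n.+1) ^+ k.

Definition mpoly (R : realType) (q c d : R) (n x : nat) : R :=
  \sum_(k < n.+1) mpolycoef q c d n k * qpoch q (q ^- x) k.

(** Its square is the quotient of [mweight q d c x] by [mweight q c d x], as expected of a
    conjugation between the two reversible operators. *)
Definition mratio (R : realType) (q c d : R) (x : nat) : R :=
  qpoch q d x / qpoch q c x * (c / d) ^+ x.

(** * q-Meixner polynomials as eigenfunctions of the birth and death operator *)

Section MeixnerPolynomials.
Variables (R : realType) (q c d : R).
Hypothesis hq : 0 < q < 1.
Hypotheses (c1 : c < 1) (c0 : c != 0) (d0 : d != 0).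

Local Notation qp := (qpoch q).

Let q_gt0 : 0 < q. Proof. by case/andP: hq. Qed.
Let q_neq0 : q != 0. Proof. by rewrite gt_eqF. Qed.
Let qf_neq0 n : qp q n != 0. Proof. exact: qfact_neq0. Qed.
Let qpc n : qp c n != 0. Proof. exact: qpoch_neq0. Qed.

Local Notation phi k x := (qp (q ^- x) k).

Lemma qpoch_qpow_gt n k : (n < k)%N -> qp (q ^- n) k = 0.
Proof.
move=> nk; rewrite -(subnKC nk) qpochD qpochS mulVf ?subrr ?mulr0 ?mul0r //.
exact: expf_neq0.
Qed.

Lemma mpoly_0 n : mpoly q c d n 0 = 1.
Proof.
rewrite /mpoly big_ord_recl /= /mpolycoef !qpoch0 expr0 !mulr1 divr1 big1 ?addr0 // => i _.
by rewrite (@qpoch_qpow_gt 0) ?mulr0.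
Qed.

Lemma phi_exp_bounded k : exp_bounded (fun x => phi k x).
Proof.
elim: k => [|k IH].
  have := bounded_exp_bounded (geom_bounded_cst (1 : R)).
  by under [X in _ -> exp_bounded X]eq_fun do rewrite qpoch0.
under eq_fun do rewrite qpochS.
apply: exp_boundedM => //; apply: exp_boundedD.
  exact/bounded_exp_bounded/geom_bounded_cst.
have := exp_boundedM (exp_bounded_exp q^-1) (bounded_exp_bounded (geom_bounded_cst (- q ^+ k))).
by under eq_fun do rewrite exprVn mulrN.
Qed.

Lemma mpoly_exp_bounded n : exp_bounded (mpoly q c d n).
Proof.
apply: exp_bounded_sum => k; apply: exp_boundedM.
  exact/bounded_exp_bounded/geom_bounded_cst.
exact: phi_exp_bounded.
Qed.

(** In the basis (q^-x; q)_k the operator is triangular with only one entry off the diagonal, so an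
    eigenvector has coefficients given by a one-step recurrence. *)
Lemma phi_meixner k x :
  birth c d (q ^+ x) * phi k.+1 x.+1 + death q d (q ^+ x) * lag (fun x' => phi k.+1 x') x
    - (birth c d (q ^+ x) + death q d (q ^+ x)) * phi k.+1 x =
  - (1 - q ^+ k.+1) * phi k.+1 x
  + (1 - q ^+ k.+1) * (d / (q * c)) * (1 - c * q ^+ k) * phi k x.
Proof.
have X0 : q ^+ x != 0 by apply: expf_neq0.
have -> : phi k.+1 x.+1 = (1 - (q * q ^+ x)^-1) * phi k x.
  by rewrite qpochSl exprS; congr (_ * qp _ _); field; rewrite X0.
have -> : death q d (q ^+ x) * lag (fun x' => phi k.+1 x') x =
    - (1 - d * q ^+ x / q) * q ^+ x * phi k.+2 x.
  case: x {X0} => [|x] /=.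
    by rewrite mulr0 (@qpoch_qpow_gt 0) ?mulr0.
  have X0 : q ^+ x != 0 by apply: expf_neq0.
  rewrite [in RHS]qpochSl (_ : q ^- x.+1 * q = q ^- x); last first.
    by rewrite exprS; field; rewrite X0.
  by rewrite /death exprS; field; rewrite X0.
rewrite !qpochS /birth /death !exprS.
by field; rewrite X0 c0 q_neq0.
Qed.

Lemma mpolycoef_rec n k :
  mpolycoef q c d n k.+1 * ((1 - q ^+ k.+1) * (d / (q * c)) * (1 - c * q ^+ k)) =
  (q ^+ n - q ^+ k) * mpolycoef q c d n k.
Proof.
have h1 := qexpS_neq1 hq k; have h2 : 1 - c * q ^+ k != 0 by apply: qfactor_neq0.
rewrite /mpolycoef !qpochS [in (_ * q ^+ n.+1) ^+ k.+1]exprS.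
move: ((c / d * q ^+ n.+1) ^+ k) => Z; move: h1; rewrite !exprS => h1.
by field; rewrite h1 h2 qf_neq0 qpc c0 d0 q_neq0 expf_neq0.
Qed.

Lemma mpoly_meixner n : meixner_eigen q c d (q ^+ n - 1) (mpoly q c d n).
Proof.
move=> x.
pose u k := mpolycoef q c d n k.
(* The off-diagonal part of the operator at k + 1 cancels the eigenvalue defect at k. The sum
   telescopes, and its last term carries q^n - q^n = 0. *)
pose W k := if k is k'.+1 then (q ^+ n - q ^+ k') * u k' * phi k' x else 0.
have lagE : lag (mpoly q c d n) x = \sum_(k < n.+1) u k * lag (fun x' => phi k x') x.
  by case: x {W} => [|x] //=; rewrite big1 // => i _; rewrite mulr0.
rewrite lagE /mpoly !mulr_sumr -big_split -sumrB /=.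
apply/eqP; rewrite -subr_eq0 -sumrB; apply/eqP.
transitivity (\sum_(0 <= k < n.+1) (W k - W k.+1)); last first.
  rewrite (@telescope_sumr_eq _ _ _ (fun k => - W k)) // => [|k _]; last by rewrite opprK addrC.
  by rewrite /W subrr !mul0r subrr.
rewrite big_mkord; apply: eq_bigr => -[k kn] _ /=; rewrite -/(u k).
case: k {kn} => [|k].
  rewrite /W; case: x {W lagE} => [|x] /=; rewrite !qpoch0 expr0; last by ring.
  by rewrite /death; ring.
transitivity (u k.+1 * (birth c d (q ^+ x) * phi k.+1 x.+1
    + death q d (q ^+ x) * lag (fun x' => phi k.+1 x') x
    - (birth c d (q ^+ x) + death q d (q ^+ x)) * phi k.+1 x)
  - (q ^+ n - 1) * u k.+1 * phi k.+1 x); first by ring.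
rewrite phi_meixner /W /u -mpolycoef_rec; ring.
Qed.
End MeixnerPolynomials.

(** * Conjugation that exchanges c and d *)

Section SecondFamily.
Variables (R : realType) (q c d : R).
Hypothesis hq : 0 < q < 1.
Hypotheses (c1 : c < 1) (c0 : c != 0) (d1 : d < 1) (d0 : d != 0).

Local Notation qp := (qpoch q).

Lemma mratio_exp_bounded : exp_bounded (mratio q c d).
Proof.
apply: exp_boundedM (exp_bounded_exp _); apply: bounded_exp_bounded.
have := geom_boundedM (qpoch_geom_bounded hq d) (qpochV_geom_bounded hq c1).
by rewrite mulr1.
Qed.

(** Conjugation by [mratio] multiplies both off-diagonal coefficients by d / c. The sum of the two
    rates scales in the same way except for its constant term, which gives the correction 1 - d /
    c. *)
Lemma mratio_meixner f mu : meixner_eigen q d c mu f ->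
  meixner_eigen q c d (d / c * (mu + 1) - 1) (fun x => mratio q c d x * f x).
Proof.
have q0 : q != 0 by case/andP: hq => h _; rewrite gt_eqF.
move=> hf x.
have qpc n : qp c n != 0 by apply: qpoch_neq0.
have qpd n : qp d n != 0 by apply: qpoch_neq0.
have -> : birth c d (q ^+ x) * (mratio q c d x.+1 * f x.+1) =
    mratio q c d x * (d / c) * (birth d c (q ^+ x) * f x.+1).
  rewrite /mratio /birth !qpochS exprS.
  have h1 : 1 - c * q ^+ x != 0 by apply: qfactor_neq0.
  by field; rewrite h1 qpc c0 d0.
have -> : death q d (q ^+ x) * lag (fun x' => mratio q c d x' * f x') x =
    mratio q c d x * (d / c) * (death q c (q ^+ x) * lag f x).
  case: x => [|x] /=; first by rewrite !mulr0.
  rewrite /mratio /death !qpochS !exprS.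
  have h1 : 1 - c * q ^+ x != 0 by apply: qfactor_neq0.
  by field; rewrite h1 qpc c0 d0 q0.
have -> : birth c d (q ^+ x) + death q d (q ^+ x) =
    d / c * (birth d c (q ^+ x) + death q c (q ^+ x)) + (1 - d / c).
  by rewrite /birth /death; field; rewrite c0 d0 q0.
transitivity (mratio q c d x * (d / c * (mu * f x)) + (d / c - 1) * mratio q c d x * f x);
  last by ring.
by rewrite -hf; ring.
Qed.
End SecondFamily.

Lemma cvg_series_unshift (R : realType) (u : nat -> R) k (l : R) :
  (forall i, (i < k)%N -> u i = 0) -> series (fun m => u (m + k)%N) @ \oo --> l ->
  series u @ \oo --> l.
Proof.
move=> u0 h; rewrite -(cvg_shiftn k (series u) (nbhs l)).
have -> // : (fun n => series u (n + k)%N) = series (fun m => u (m + k)%N).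
apply/funext => n; rewrite series_shift [X in X + _](_ : _ = 0) ?add0r //.
by rewrite /series /= big_nat big1 // => i /andP[_ /u0].
Qed.

(** * Eigenvalues as values at the origin *)

Section Values.
Variables (R : realType) (q a1 b1 a2 d : R).
Hypothesis hq : 0 < q < 1.
Hypotheses (ha1 : 0 < a1 < 1) (hb1 : 0 < b1 < 1) (ha2 : 0 < a2 < 1) (hd : d < 0).
Implicit Types (f : nat -> R) (i j k m n x y : nat).

Local Notation qp := (qpoch q).
Local Notation qi := (qpoch_inf q).
Local Notation core := (core q a1 b1 a2 d).
Local Notation coreterm := (coreterm q a1 b1 a2 d).
Local Notation phi k x := (qp (q ^- x) k).

Let q_gt0 : 0 < q. Proof. by case/andP: hq. Qed.
Let q_lt1 : q < 1. Proof. by case/andP: hq. Qed.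
Let q_neq0 : q != 0. Proof. by rewrite gt_eqF. Qed.
Let qf_neq0 n : qp q n != 0. Proof. exact: qfact_neq0. Qed.
Let a1_lt1 : a1 < 1. Proof. by case/andP: ha1. Qed.
Let b1_lt1 : b1 < 1. Proof. by case/andP: hb1. Qed.
Let a2_lt1 : a2 < 1. Proof. by case/andP: ha2. Qed.
Let a1_gt0 : 0 < a1. Proof. by case/andP: ha1. Qed.
Let b1_gt0 : 0 < b1. Proof. by case/andP: hb1. Qed.
Let a2_gt0 : 0 < a2. Proof. by case/andP: ha2. Qed.
Let a1_neq0 : a1 != 0. Proof. by rewrite gt_eqF. Qed.
Let b1_neq0 : b1 != 0. Proof. by rewrite gt_eqF. Qed.
Let d_lt1 : d < 1. Proof. by rewrite (lt_trans hd). Qed.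
Let a2d_le0 : a2 * d <= 0. Proof. by rewrite ltW // pmulr_rlt0. Qed.
Let a2d_lt1 : a2 * d < 1. Proof. by rewrite (le_lt_trans a2d_le0). Qed.
Let b1a2_lt1 : b1 * a2 < 1. Proof. by rewrite mulr_ilt1 // ltW. Qed.
Let a1b1_lt1 : a1 * b1 < 1. Proof. by rewrite mulr_ilt1 // ltW. Qed.
Let c := a1 * b1.
Let a2dn n : qp (a2 * d) n != 0. Proof. exact: qpoch_neq0. Qed.
Let b1a2n n : qp (b1 * a2) n != 0. Proof. exact: qpoch_neq0. Qed.
Let cn n : qp c n != 0. Proof. exact: qpoch_neq0. Qed.

Lemma bin2D m n : 'C(m + n, 2) = ('C(m, 2) + 'C(n, 2) + m * n)%N.
Proof.
elim: m => [|m IH]; first by rewrite !add0n mul0n addn0.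
rewrite addSn !binS !bin1 IH mulSn.
by move: 'C(m, 2) 'C(n, 2) (m * n)%N => s t p; clear; lia.
Qed.

(** A form of (q^-n; q)_k / (q; q)_n = (-1)^k q^('C(k, 2) - n k) / (q; q)_(n-k) at n = m + k. Since
    phi k vanishes below k, it reduces sums against phi k to sums without it, with shifted
    parameters. *)
Lemma phi_shift k m (z : R) :
  phi k (m + k) / qp q (m + k) * ((- z) ^+ (m + k) * q ^+ 'C(m + k, 2)) =
  (z / q) ^+ k * ((- z) ^+ m * q ^+ 'C(m, 2) / qp q m).
Proof.
elim: k z => [|k IH] z.
  by rewrite addn0 qpoch0 !expr0; ring.
have X0 : q ^+ (m + k) != 0 by apply: expf_neq0.
have h1 := qexpS_neq1 hq (m + k).
have -> : phi k.+1 (m + k.+1) = (1 - q ^- (m + k).+1) * phi k (m + k).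
  by rewrite addnS qpochSl; congr (_ * qp _ _); rewrite exprS; field; rewrite X0.
transitivity (z / q * ((z / q) ^+ k * ((- z) ^+ m * q ^+ 'C(m, 2) / qp q m))); last first.
  by rewrite exprS mulrA.
rewrite -IH addnS; move: (m + k)%N X0 h1 => p X0 h1; rewrite exprS in h1.
rewrite qpochS binS bin1 exprD !(exprS _ p).
by field; rewrite h1 X0 q_neq0 qf_neq0.
Qed.

Lemma phi_shiftE k m : phi k (m + k) / qp q (m + k) =
  (- q^-1) ^+ k * q ^- 'C(k, 2) * (q ^- (m * k) / qp q m).
Proof.
have := phi_shift k m (-1); rewrite opprK !expr1n !mul1r bin2D !exprD => h.
have nz (p : nat) : q ^+ p != 0 by apply: expf_neq0.
have nz' : q ^+ 'C(m, 2) * q ^+ 'C(k, 2) * q ^+ (m * k) != 0 by rewrite !mulf_neq0.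
apply: (mulIf nz'); rewrite h mulN1r; field.
by rewrite ?nz ?qf_neq0 ?q_neq0.
Qed.

Lemma sum_ord_unshift (F : nat -> R) k m : (forall i, (i < k)%N -> F i = 0) ->
  \sum_(i < (m + k).+1) F i = \sum_(i < m.+1) F (i + k)%N.
Proof.
move=> F0; rewrite -addSn addnC big_split_ord /= big1 ?add0r => [|i _]; last exact: F0.
by apply: eq_bigr => i _; rewrite addnC.
Qed.

(** Shifting the index by k leaves the q-Vandermonde sum with a replaced by a q^k. *)
Lemma qHahn_moment a b k n : a * b < 1 ->
  \sum_(i < n.+1) qp a i * qp b (n - i) * a ^+ (n - i) / (qp q i * qp q (n - i)) * phi k i =
  phi k n * qp a k * qp (a * b) n / (qp (a * b) k * qp q n).
Proof.
move=> ab1; have abn m : qp (a * b) m != 0 by apply: qpoch_neq0.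
have [nk|kn] := ltnP n k.
  rewrite (qpoch_qpow_gt hq nk) !mul0r big1 // => i _.
  by rewrite (qpoch_qpow_gt hq) ?mulr0 // (leq_ltn_trans _ nk) // -ltnS.
have [m ->] : exists m, n = (m + k)%N by exists (n - k)%N; rewrite subnK.
have -> : phi k (m + k) * qp a k * qp (a * b) (m + k) / (qp (a * b) k * qp q (m + k)) =
    phi k (m + k) / qp q (m + k) * qp a k * qp (a * b * q ^+ k) m.
  rewrite (addnC m k) (qpochD q (a * b)); field.
  by rewrite abn qf_neq0.
rewrite phi_shiftE (sum_ord_unshift (F := fun i => qp a i * qp b (m + k - i) * a ^+ (m + k - i)
  / (qp q i * qp q (m + k - i)) * phi k i)); last by move=> i ik; rewrite qpoch_qpow_gt ?mulr0.
have V := qVandermonde hq (a * q ^+ k) b m.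
rewrite (_ : a * q ^+ k * b = a * b * q ^+ k) in V; last by ring.
transitivity ((- q^-1) ^+ k * q ^- 'C(k, 2) * q ^- (m * k) * qp a k *
  (qp (a * b * q ^+ k) m / qp q m)); last by ring.
rewrite -V mulr_sumr; apply: eq_bigr => -[i im] _ /=.
have le_im : (i <= m)%N by rewrite -ltnS.
rewrite subnDr (addnC i k) (qpochD q a) (addnC k i).
transitivity (qp a k * qp (a * q ^+ k) i * qp b (m - i) * a ^+ (m - i) / qp q (m - i)
  * (phi k (i + k) / qp q (i + k))); first by field; rewrite !qf_neq0.
rewrite phi_shiftE exprMn -exprM.
have -> : q ^+ (m * k) = q ^+ (i * k) * q ^+ (k * (m - i)).
  by rewrite -exprD; congr (_ ^+ _); rewrite (mulnC k) -mulnDl subnKC.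
have nz (p : nat) : q ^+ p != 0 by apply: expf_neq0.
by field; rewrite !nz !qf_neq0.
Qed.

(** At fixed i only the finitely many y <= i contribute, and there the q-Hahn moments apply; hence
    the exchange of the two summations. *)
Lemma core_diagonal x f : exp_bounded f -> exists L : R,
  series (fun y => core x y * f y) @ \oo --> L /\
  series (fun i => \sum_(y < i.+1) coreterm x y i * f y) @ \oo --> L.
Proof.
move=> [s s0 /geom_bounded_ge0[D D0 hD]].
(* With s + 1 >= 1 the growth s^y is at most (s + 1)^i for y <= i, and the rate 1 / (2 (s + 1))
   leaves (1/2)^i. *)
have t0 : 0 < 2 * (s + 1) by rewrite mulr_gt0 // addr_gt0.
have [C C0 hC] := coreterm_bound a1 hq hb1 ha2 hd x (divr_gt0 ltr01 t0).
pose T m y := f y * coreterm x y (m + y).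
have hT m y : `|T m y| <= (D * C) * (1 / 2) ^+ (m + y).
  have -> : (1 / 2 : R) = (s + 1) * (1 / (2 * (s + 1))).
    by field; rewrite gt_eqF // addr_gt0.
  rewrite exprMn mulrACA normrM ler_pM // (le_trans (hD y)) // ler_wpM2l //.
  apply: (@le_trans _ _ ((s + 1) ^+ y)).
    by rewrite lerXn2r ?nnegrE ?lerDl // ltW // addr_gt0.
  by rewrite ler_weXn2l ?leq_addl // lerDr ltW.
have half : 0 <= (1 / 2 : R) < 1 by lra.
have [L [h1 h2]] := cvg_series_diagonal half hT.
exists L; split.
- apply: (eq_cvg_series _ h1) => y.
  have col : series (T^~ y) @ \oo --> f y * core x y.
    apply: cvg_seriesZ.
    have := cvg_series_shift (k := y) (cvg_core (a1 := a1) hq hb1 ha2 hd (x := x) (y := y)).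
    rewrite [X in _ - X](_ : _ = 0) ?subr0 //.
    by rewrite /series /= big_nat big1 // => i /andP[_ iy]; apply: coreterm_lt.
  by rewrite (cvg_lim _ col) // mulrC.
- apply: (eq_cvg_series _ h2) => i; apply: eq_bigr => -[y yi] _ /=.
  by rewrite /T subnK // mulrC.
Qed.

(** Only j = 0 contributes. Multiplied by b1 ^- y, the last factor is, as a function of y,
    proportional to the q-Hahn weight on 0..i with parameters b1 and a2. *)
Lemma coreterm0 y i : (y <= i)%N -> coreterm 0 y i =
  (- (b1 * d)) ^+ i * q ^+ 'C(i, 2) / (qp (a2 * d) i * qp (b1 * a2) i) * qp a2 i *
  (qp b1 y * qp a2 (i - y) / (qp q y * qp q (i - y))).
Proof.
move=> yi; rewrite /coreterm big_ord_recl big_ord0 addr0 /= /rho /cz /wt /= yi !subn0.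
rewrite !qpoch0 !expr0; field.
by rewrite !qf_neq0 a2dn b1a2n.
Qed.

(** At fixed i the sum over y is a q-Hahn moment. It contains phi k i, so the sum over i starts at k
    and is a 1phi1 sum with a2 q^k for a2. *)
Lemma phi_moment k :
  series (fun y => core 0%N y * (b1 ^- y * phi k y)) @ \oo -->
  qi d / qi (a2 * d) * (qp b1 k * qp a2 k / qp (b1 * a2) k * (d / q) ^+ k).
Proof.
have eb : exp_bounded (fun y => b1 ^- y * phi k y).
  apply: exp_boundedM; last exact: phi_exp_bounded.
  by have := exp_bounded_exp b1^-1; under eq_fun do rewrite exprVn.
have [L [h1 h2]] := core_diagonal 0 eb.
suff h3 : series (fun i => \sum_(y < i.+1) coreterm 0%N y i * (b1 ^- y * phi k y)) @ \oo -->
    qi d / qi (a2 * d) * (qp b1 k * qp a2 k / qp (b1 * a2) k * (d / q) ^+ k).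
  by rewrite (cvg_series_unique h3 h2).
have diagE i : \sum_(y < i.+1) coreterm 0%N y i * (b1 ^- y * phi k y) =
    qp b1 k / qp (b1 * a2) k * (qp a2 i / qp (a2 * d) i) *
    (phi k i / qp q i * ((- d) ^+ i * q ^+ 'C(i, 2))).
  transitivity ((- d) ^+ i * q ^+ 'C(i, 2) / (qp (a2 * d) i * qp (b1 * a2) i) * qp a2 i *
    (phi k i * qp b1 k * qp (b1 * a2) i / (qp (b1 * a2) k * qp q i))); last first.
    by field; rewrite a2dn !b1a2n qf_neq0.
  rewrite -qHahn_moment // mulr_sumr; apply: eq_bigr => -[y yi] _ /=.
  rewrite coreterm0 // -mulrN (exprMn i b1) -{1}(subnK (n := i) (m := y)) // exprD.
  by field; rewrite ?a2dn ?b1a2n ?qf_neq0 ?expf_neq0.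
have ad : a2 * q ^+ k * d <= 0 by rewrite mulrAC pmulr_lle0 // (qexp_gt0 hq).
have := cvg_seriesZ (c := qp b1 k / qp (b1 * a2) k * (qp a2 k / qp (a2 * d) k) * (d / q) ^+ k)
  (qphi11_sum hq ad).
rewrite (_ : qp b1 k / _ * _ * _ * _ =
    qi d / qi (a2 * d) * (qp b1 k * qp a2 k / qp (b1 * a2) k * (d / q) ^+ k)); last first.
  rewrite (qpoch_infD hq (a2 * d) k) (_ : a2 * q ^+ k * d = a2 * d * q ^+ k); last by ring.
  have h : qi (a2 * d * q ^+ k) != 0.
    by apply: qpoch_inf_neq0 => //; apply: mul_qexp_lt1.
  by move: (a2dn k) (b1a2n k) => h' h''; move: ((d / q) ^+ k) => D; field; rewrite h h' h''.
move=> h; apply: (@cvg_series_unshift _ _ k) => [i ik|].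
  by rewrite diagE (qpoch_qpow_gt hq ik) !mul0r mulr0.
apply: (eq_cvg_series _ h) => m; rewrite diagE phi_shift (addnC m k) !qpochD.
have -> : a2 * q ^+ k * d = a2 * d * q ^+ k by ring.
have h' : qp (a2 * d * q ^+ k) m != 0.
  by apply: qpoch_neq0 => //; apply: mul_qexp_lt1.
move: (a2dn k) (b1a2n k) (qf_neq0 m) h' => h1' h2' h3' h'.
by move: ((d / q) ^+ k) => D; field; rewrite h1' h2' h3' h'.
Qed.

(** The terms of 2phi1(a2 q^y, d q^y; a2 d q^y; q, b1). *)
Definition phi21 y r : R :=
  qp (a2 * q ^+ y) r * qp (d * q ^+ y) r / (qp (d * q ^+ y * a2) r * qp q r) * b1 ^+ r.

(** The transformed series has the merit that (a2; q)_y and (a2 d; q)_y merge with its terms into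
    products of length y + r; so does the factor (d; q)_y coming from [mratio]. *)
Lemma core0E y : exists L : R, series (phi21 y) @ \oo --> L /\
  core 0%N y * b1 ^- y = qi b1 / qi (b1 * a2) *
    (qp b1 y * qp a2 y * ((- d) ^+ y * q ^+ 'C(y, 2)) / (qp q y * qp (a2 * d) y)) * L.
Proof.
have hb : 0 <= b1 < 1 by rewrite ltW.
have az : a2 * q ^+ y * b1 < 1.
  by rewrite (_ : _ * b1 = b1 * a2 * q ^+ y); [apply: mul_qexp_lt1|ring].
have be : d * q ^+ y * a2 < 1.
  by rewrite (_ : _ * a2 = a2 * d * q ^+ y); [apply: mul_qexp_lt1|ring].
have [L [h1 h2]] := qphi21_jackson hq hb az be.
exists L; split=> //.
have col := cvg_series_shift (k := y) (cvg_core (a1 := a1) hq hb1 ha2 hd (x := 0%N) (y := y)).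
rewrite [X in _ - X](_ : _ = 0) ?subr0 in col; last first.
  by rewrite /series /= big_nat big1 // => i /andP[_ iy]; apply: coreterm_lt.
have iaz : qi (a2 * q ^+ y * b1) != 0 by apply: qpoch_inf_neq0.
have e1 : a2 * q ^+ y * b1 = b1 * a2 * q ^+ y by ring.
have h3 := cvg_seriesZ (c := b1 ^+ y * (qp b1 y * qp a2 y * ((- d) ^+ y * q ^+ 'C(y, 2)) /
  (qp q y * qp (a2 * d) y * qp (b1 * a2) y))) h1.
have -> : core 0%N y = b1 ^+ y * (qp b1 y * qp a2 y * ((- d) ^+ y * q ^+ 'C(y, 2)) /
  (qp q y * qp (a2 * d) y * qp (b1 * a2) y)) * (qi b1 / qi (a2 * q ^+ y * b1) * L).
  apply: (cvg_series_unique col); apply: (eq_cvg_series _ h3) => m.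
  rewrite coreterm0 ?leq_addl // addnK bin2D !exprD (addnC m y) !qpochD.
  have s1 (p : nat) : (- (b1 * d)) ^+ p = (- d) ^+ p * b1 ^+ p by rewrite -mulrN exprMn mulrC.
  have s2 : (- (d * q ^+ y * b1)) ^+ m = (- d) ^+ m * (q ^+ y) ^+ m * b1 ^+ m.
    by rewrite -!mulNr !exprMn.
  rewrite !s1 s2.
  rewrite e1 (_ : d * q ^+ y * a2 = a2 * d * q ^+ y); last by ring.
  have n1 : qp (a2 * d * q ^+ y) m != 0 by apply: qpoch_neq0 => //; apply: mul_qexp_lt1.
  have n2 : qp (b1 * a2 * q ^+ y) m != 0 by apply: qpoch_neq0 => //; apply: mul_qexp_lt1.
  rewrite (mulnC m y) exprM.
  by field; rewrite n1 n2 !qf_neq0 a2dn b1a2n.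
rewrite (qpoch_infD hq (b1 * a2) y) -e1.
by field; rewrite iaz qf_neq0 a2dn b1a2n expf_neq0.
Qed.

Definition sterm k j : R :=
  qp a1 j * qp (a2 * q ^+ k) j * qp (d * q ^+ k) j /
  (qp (a2 * d * q ^+ k) j * qp (c * q ^+ k) j * qp q j) * b1 ^+ j.

Lemma sterm_cvg k : cvgn (series (sterm k)).
Proof.
apply: (@geom_bounded_is_cvg _ _ b1); first by rewrite ltW.
have cq : c * q ^+ k < 1 by apply: mul_qexp_lt1.
have aq : a2 * d * q ^+ k < 1 by apply: mul_qexp_lt1.
have h := geom_bounded1M (geom_bounded1M (geom_bounded1M (geom_bounded1M (geom_bounded1M (qpoch_geom_bounded hq a1)
  (qpoch_geom_bounded hq (a2 * q ^+ k))) (qpoch_geom_bounded hq (d * q ^+ k)))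
  (qpochV_geom_bounded hq aq)) (qpochV_geom_bounded hq cq)) (qpochV_geom_bounded hq q_lt1).
have := geom_boundedM h (geom_bounded_exp b1).
rewrite mul1r gtr0_norm // => -[C hC]; exists C => n.
by have := hC n; rewrite /sterm !invfM !mulrA.
Qed.

Let xterm k y : R := qp b1 y * ((- c) ^+ y * q ^+ 'C(y, 2)) / qp c y * (phi k y / qp q y).

Let xterm_rapid k : rapid (xterm k).
Proof.
have [s s0 hs] := exp_boundedM (exp_bounded_exp (- c)) (phi_exp_bounded q k).
have := rapidMbounded (rapidMbounded (rapidMbounded (rapidMgeom s0 (rapid_qbin hq) hs)
  (qpoch_geom_bounded hq b1)) (qpochV_geom_bounded hq a1b1_lt1)) (qpochV_geom_bounded hq q_lt1).
by apply: eq_rapid => y; rewrite /xterm; ring.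
Qed.

(** The sum starts at y = k; after the shift it is [qVandermonde_rev] with b1 q^k for b and a1 for
    e. *)
Let xterm_sum k m :
  \sum_(y < (m + k).+1) xterm k y * (b1 ^+ (m + k - y) / qp q (m + k - y)) =
  (c / q) ^+ k * (qp b1 k / qp c k) *
  (qp a1 m / (qp (c * q ^+ k) m * qp q m) * b1 ^+ m).
Proof.
rewrite (sum_ord_unshift (F := fun y => xterm k y * (b1 ^+ (m + k - y) / qp q (m + k - y)))); last first.
  by move=> i ik; rewrite /xterm qpoch_qpow_gt // !(mul0r, mulr0).
have cq n : qp (c * q ^+ k) n != 0 by apply: qpoch_neq0 => //; apply: mul_qexp_lt1.
have V := qVandermonde_rev hq (b1 * q ^+ k) a1 m.
rewrite (_ : b1 * q ^+ k * a1 = c * q ^+ k) in V; last by rewrite /c; ring.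
transitivity ((c / q) ^+ k * (qp b1 k / qp c k) / qp (c * q ^+ k) m * b1 ^+ m *
  (qp a1 m / qp q m)); last by move: (cq m) (cn k) (qf_neq0 m) => h1 h2 h3; field; rewrite h1 h2 h3.
rewrite -V mulr_sumr; apply: eq_bigr => -[i im] _ /=.
have le_im : (i <= m)%N by rewrite -ltnS.
transitivity (qp b1 (i + k) / qp c (i + k) *
  (phi k (i + k) / qp q (i + k) * ((- c) ^+ (i + k) * q ^+ 'C(i + k, 2))) *
  (b1 ^+ (m - i) / qp q (m - i))).
  by rewrite /xterm subnDr; move: (cn (i + k)) (qf_neq0 (i + k)) (qf_neq0 (m - i)) => h1 h2 h3;
    field; rewrite h1 h2 h3.
rewrite phi_shift (addnC i k) !qpochD.
have -> : b1 ^+ m = b1 ^+ i * b1 ^+ (m - i) by rewrite -exprD subnKC.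
have E : qp (c * q ^+ k) m = qp (c * q ^+ k) i * qp (c * q ^+ k * q ^+ i) (m - i).
  by rewrite -qpochD subnKC.
have h4 : qp (c * q ^+ k * q ^+ i) (m - i) != 0.
  by apply: qpoch_neq0 => //; do 2 apply: mul_qexp_lt1 => //.
have -> : (- c) ^+ i = (- a1) ^+ i * b1 ^+ i by rewrite -exprMn mulNr.
rewrite E; move: (cq i) (cn k) (qf_neq0 i) (qf_neq0 (m - i)) ((c / q) ^+ k) => h1 h2 h3 h5 Z.
by field; rewrite h1 h2 h3 h4 h5.
Qed.

Lemma mratio_moment k :
  series (fun y => core 0%N y * (b1 ^- y * (mratio q c d y * phi k y))) @ \oo -->
  qi b1 / qi (b1 * a2) * ((c / q) ^+ k *
    (qp b1 k * qp a2 k * qp d k / (qp (a2 * d) k * qp c k)) * limn (series (sterm k))).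
Proof.
(* The factors depending on r + y only: w is constant on each diagonal, and what is left is summed
   by [xterm_sum]. *)
pose w n := qp a2 n * qp d n / qp (a2 * d) n.
pose T r y := xterm k y * (w (r + y)%N * (b1 ^+ r / qp q r)).
have [C1 C10 hC1] := geom_bounded_ge0 (xterm_rapid k b1_gt0).
have [C2 C20 hC2] : exists2 C : R, 0 <= C & forall n, `|w n| <= C * 1 ^+ n.
  have := geom_boundedM (geom_boundedM (qpoch_geom_bounded hq a2) (qpoch_geom_bounded hq d))
    (qpochV_geom_bounded hq a2d_lt1).
  by rewrite !mulr1 => /geom_bounded_ge0.
have [C3 C30 hC3] := geom_bounded_ge0 (qpochV_geom_bounded hq q_lt1).
have hT r y : `|T r y| <= C1 * (C2 * C3) * b1 ^+ (r + y).
  rewrite (_ : _ * b1 ^+ (r + y) = (C1 * b1 ^+ y) * (C2 * (b1 ^+ r * C3))); last first.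
    by rewrite exprD; ring.
  rewrite normrM ler_pM // normrM ler_pM //.
    by have := hC2 (r + y)%N; rewrite expr1n mulr1.
  rewrite normrM (gtr0_norm (exprn_gt0 r b1_gt0)) ler_wpM2l //.
    by rewrite exprn_ge0 // ltW.
  by have := hC3 r; rewrite expr1n mulr1.
have hb : 0 <= b1 < 1 by rewrite ltW.
have [L [h1 h2]] := cvg_series_diagonal hb hT.
have colE y : core 0%N y * (b1 ^- y * (mratio q c d y * phi k y)) =
    qi b1 / qi (b1 * a2) * limn (series (T^~ y)).
  have [M [hM ->]] : exists M : R, series (phi21 y) @ \oo --> M /\
      core 0%N y * (b1 ^- y * (mratio q c d y * phi k y)) =
      qi b1 / qi (b1 * a2) * (xterm k y * w y * M).
    have [M [hM eM]] := core0E y; exists M; split=> //.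
    rewrite [LHS]mulrA eM /xterm /w /mratio.
    have -> : (- c) ^+ y = (- d) ^+ y * (c / d) ^+ y.
      by rewrite -exprMn; congr (_ ^+ _); field; rewrite lt_eqF.
    move: (cn y) (a2dn y) (qf_neq0 y) ((c / d) ^+ y) (qi b1 / qi (b1 * a2)) => g1 g2 g3 Z K.
    by field; rewrite g1 g2 g3.
  congr (_ * _); apply/esym; apply: cvg_lim => //.
  apply: (eq_cvg_series _ (cvg_seriesZ (c := xterm k y * w y) hM)) => r.
  rewrite /T /w /phi21 (addnC r y) !qpochD (_ : d * q ^+ y * a2 = a2 * d * q ^+ y); last by ring.
  have g1 : qp (a2 * d * q ^+ y) r != 0 by apply: qpoch_neq0 => //; apply: mul_qexp_lt1.
  by move: (a2dn y) (qf_neq0 r) => g2 g3; field; rewrite g1 g2 g3.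
apply: (@eq_cvg_series _ (fun y => qi b1 / qi (b1 * a2) * limn (series (T^~ y)))) => //.
apply: cvg_seriesZ.
suff h3 : series (fun n => \sum_(i < n.+1) T (n - i)%N i) @ \oo -->
    (c / q) ^+ k * (qp b1 k * qp a2 k * qp d k / (qp (a2 * d) k * qp c k)) *
    limn (series (sterm k)) by rewrite (cvg_series_unique h3 h2).
have diagE n : \sum_(i < n.+1) T (n - i)%N i =
    w n * \sum_(y < n.+1) xterm k y * (b1 ^+ (n - y) / qp q (n - y)).
  rewrite mulr_sumr; apply: eq_bigr => -[y yn] _ /=.
  by rewrite /T subnK 1?mulrCA // -ltnS.
apply: (@cvg_series_unshift _ _ k) => [i ik|].
  rewrite big1 // => -[y yi] _ /=.
  by rewrite /T /xterm qpoch_qpow_gt ?(mul0r, mulr0) // (leq_trans yi).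
apply: (eq_cvg_series _ (cvg_seriesZ (c := (c / q) ^+ k *
  (qp b1 k * qp a2 k * qp d k / (qp (a2 * d) k * qp c k))) (sterm_cvg (k := k)))) => m.
rewrite diagE xterm_sum /sterm /w (addnC m k) !qpochD.
have g1 : qp (a2 * d * q ^+ k) m != 0 by apply: qpoch_neq0 => //; apply: mul_qexp_lt1.
have g2 : qp (c * q ^+ k) m != 0 by apply: qpoch_neq0 => //; apply: mul_qexp_lt1.
move: (cn k) (a2dn k) (qf_neq0 m) ((c / q) ^+ k) => g3 g4 g5 Z.
by field; rewrite g1 g2 g3 g4 g5.
Qed.
End Values.

(** * The Markov kernel *)

Section Assembly.
Variables (R : realType) (q a1 b1 a2 b2 d : R).
Hypothesis hq : 0 < q < 1.
Hypotheses (ha1 : 0 < a1 < 1) (hb1 : 0 < b1 < 1) (ha2 : 0 < a2 < 1) (hd : d < 0).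
Hypothesis b2E : b2 = - (a2 * d).
Implicit Types (f : nat -> R) (i j k m n x y : nat).

Local Notation qp := (qpoch q).
Local Notation qi := (qpoch_inf q).
Local Notation core := (core q a1 b1 a2 d).
Local Notation coreterm := (coreterm q a1 b1 a2 d).
Local Notation rho := (rho q a1 b1 a2 d).
Local Notation cz := (cz q b1 a2).
Local Notation phi k x := (qp (q ^- x) k).
Local Notation K := (kernelK q a1 b1 a2 b2).
Local Notation c := (a1 * b1).
Local Notation mw := (mweight q c d).

Let q_gt0 : 0 < q. Proof. by case/andP: hq. Qed.
Let q_lt1 : q < 1. Proof. by case/andP: hq. Qed.
Let q_neq0 : q != 0. Proof. by rewrite gt_eqF. Qed.
Let qf_neq0 n : qp q n != 0. Proof. exact: qfact_neq0. Qed.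
Let a1_lt1 : a1 < 1. Proof. by case/andP: ha1. Qed.
Let b1_lt1 : b1 < 1. Proof. by case/andP: hb1. Qed.
Let a2_lt1 : a2 < 1. Proof. by case/andP: ha2. Qed.
Let a1_gt0 : 0 < a1. Proof. by case/andP: ha1. Qed.
Let b1_gt0 : 0 < b1. Proof. by case/andP: hb1. Qed.
Let a2_gt0 : 0 < a2. Proof. by case/andP: ha2. Qed.
Let a1_neq0 : a1 != 0. Proof. by rewrite gt_eqF. Qed.
Let b1_neq0 : b1 != 0. Proof. by rewrite gt_eqF. Qed.
Let a2_neq0 : a2 != 0. Proof. by rewrite gt_eqF. Qed.
Let d_neq0 : d != 0. Proof. by rewrite lt_eqF. Qed.
Let d_lt1 : d < 1. Proof. by rewrite (lt_trans hd). Qed.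
Let a2d_le0 : a2 * d <= 0. Proof. by rewrite ltW // pmulr_rlt0. Qed.
Let a2d_lt1 : a2 * d < 1. Proof. by rewrite (le_lt_trans a2d_le0). Qed.
Let b1a2_lt1 : b1 * a2 < 1. Proof. by rewrite mulr_ilt1 // ltW. Qed.
Let c_lt1 : c < 1. Proof. by rewrite mulr_ilt1 // ltW. Qed.
Let c_neq0 : c != 0. Proof. by rewrite mulf_neq0. Qed.
Let a2dn n : qp (a2 * d) n != 0. Proof. exact: qpoch_neq0. Qed.
Let b1a2n n : qp (b1 * a2) n != 0. Proof. exact: qpoch_neq0. Qed.
Let cn n : qp c n != 0. Proof. exact: qpoch_neq0. Qed.
Let dn n : qp d n != 0. Proof. exact: qpoch_neq0. Qed.
Let b1n n : qp b1 n != 0. Proof. exact: qpoch_neq0. Qed.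
Let a1n n : qp a1 n != 0. Proof. exact: qpoch_neq0. Qed.
Let mdc_gt0 : 0 < - (d / c).
Proof. by rewrite -mulNr divr_gt0 ?oppr_gt0 // mulr_gt0. Qed.
Let Nb2 : - b2 = a2 * d. Proof. by rewrite b2E opprK. Qed.
Let Vb2 : a2^-1 * b2 = - d. Proof. by rewrite b2E mulrN mulKf. Qed.

Let C0 := qi (a2 * d) / qi d.

Let C0_gt0 : 0 < C0. Proof. by rewrite divr_gt0 // qpoch_inf_gt0. Qed.

Lemma mweight_gt0 x : 0 < mw x.
Proof.
by rewrite /mweight !mulr_gt0 ?invr_gt0 ?mulr_gt0 ?qpoch_gt0 ?exprn_gt0.
Qed.

Let mw_neq0 x : mw x != 0. Proof. by rewrite gt_eqF // mweight_gt0. Qed.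

Let expB (a : R) m n : a != 0 -> (n <= m)%N -> a ^+ (m - n) = a ^+ m / a ^+ n.
Proof. by move=> a0 nm; rewrite -[in RHS](subnK nm) exprD mulfK // expf_neq0. Qed.

(** The q-Hahn weight in x supplies [cz x i j]. At y the same function comes from two sources:
    [wt b1 y j] from the q-Hahn weight with second parameter b1, and [wt a2 i y] from [upWeight].
    This match of parameters is the origin of the symmetry. *)
Lemma qHahn_innerTerm x y j i : (j <= minn x y)%N -> (maxn x y <= i)%N ->
  qHahn q j y a1 b1 * innerTerm q b1 a2 b2 x y j i =
  C0 / mw y * b1 ^- x * b1 ^- y * (rho i j * (cz x i j * cz y i j)).
Proof.
rewrite leq_min geq_max => /andP[jx jy] /andP[xi yi].
have ji := leq_trans jx xi.
rewrite /innerTerm /qHahn /upWeight Vb2 Nb2 opprK /mweight /rho /cz /wt jx jy xi yi.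
rewrite (_ : (i - j - (x - j) = i - x)%N); last by rewrite subnBA // subnK.
have C2 : ('C(y, 2) <= 'C(i, 2))%N by apply: leq_bin2l.
rewrite -/C0 !expB ?oppr_eq0 //.
have e1 : (- (b1 * d)) ^+ i = b1 ^+ i * (- d) ^+ i by rewrite -mulrN exprMn.
have e2 : (- (d / c)) ^+ y = (- d) ^+ y / (a1 ^+ y * b1 ^+ y).
  by rewrite -mulNr expr_div_n exprMn.
rewrite e1 e2.
have g1 (a : R) p : a != 0 -> a ^+ p != 0 := expf_neq0 p.
have nd : - d != 0 by rewrite oppr_eq0.
move: ((- d) ^+ y) ((- d) ^+ i) (g1 _ y nd) => dy di ndy.
by field; rewrite ?qf_neq0 ?a2dn ?b1a2n ?cn ?dn ?g1 ?ndy.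
Qed.

Let qHahn_neq0 j y : qHahn q j y a1 b1 != 0.
Proof.
by rewrite /qHahn !mulf_neq0 ?invr_eq0 ?qf_neq0 ?mulf_neq0 ?expf_neq0.
Qed.

Let gterm x y j i : R := rho i j * (cz x i j * cz y i j).

Let gterm_cvg x y j : series (gterm x y j) @ \oo --> limn (series (gterm x y j)).
Proof.
have := rapidMbounded (rapidMbounded (rho_rapid a1 hq hb1 ha2 hd j)
  (cz_geom_bounded hq hb1 ha2 id (fun=> j) x)) (cz_geom_bounded hq hb1 ha2 id (fun=> j) y).
move=> h; have half : 0 <= (1 / 2 : R) < 1 by lra.
apply: (geom_bounded_is_cvg half).
have half0 : 0 < (1 / 2 : R) by lra.
by have [C hC] := h _ half0; exists C => i; rewrite /gterm mulrA hC.
Qed.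

Let gterm_lt x y j i : (i < maxn x y)%N -> gterm x y j i = 0.
Proof. by rewrite leq_max /gterm => /orP[/cz_gt_i ->|/cz_gt_i ->]; rewrite !(mul0r, mulr0). Qed.

Let kap x y : R := C0 / mw y * b1 ^- x * b1 ^- y.

Let inner_series x y j : (j <= minn x y)%N ->
  (fun N => \sum_(maxn x y <= i < N) innerTerm q b1 a2 b2 x y j i) @ \oo -->
  (qHahn q j y a1 b1)^-1 * (kap x y * limn (series (gterm x y j))).
Proof.
move=> hj.
have -> : (fun N => \sum_(maxn x y <= i < N) innerTerm q b1 a2 b2 x y j i) =
    (fun N => (qHahn q j y a1 b1)^-1 * (kap x y * series (gterm x y j) N)).
  apply/funext => N; apply: (mulfI (qHahn_neq0 j y)); rewrite mulVKf ?qHahn_neq0 //.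
  rewrite mulr_sumr /series /=.
  rewrite (@big_nat_widenl _ _ _ _ 0) // mulr_sumr [RHS](bigID (fun i => (maxn x y <= i)%N)) /=.
  rewrite [X in _ + X]big1 ?addr0 => [|i]; last by rewrite -ltnNge => /gterm_lt ->; rewrite mulr0.
  by apply: eq_big => // i h; rewrite qHahn_innerTerm.
by do 2 apply: cvgMr; apply: gterm_cvg.
Qed.

Lemma inner_is_cvg x y j : (j <= minn x y)%N ->
  cvgn (fun N => \sum_(maxn x y <= i < N) innerTerm q b1 a2 b2 x y j i).
Proof. by move=> hj; apply/cvg_ex; eexists; apply: inner_series. Qed.

Lemma kernelKE x y : K x y = C0 / mw y * b1 ^- x * b1 ^- y * core x y.
Proof.
have -> : core x y = \sum_(j < (minn x y).+1) limn (series (gterm x y j)).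
  apply: (cvg_series_unique (cvg_core (a1 := a1) hq hb1 ha2 hd (x := x) (y := y))).
  apply: (eq_cvg_series _ (cvg_series_sum (s := index_enum 'I_(minn x y).+1)
    (fun j : 'I_(minn x y).+1 => gterm_cvg (x := x) (y := y) (j := j)))) => i.
  (* [coreterm] truncates j at its first argument, so for y < x the arguments are exchanged to reach
     [minn x y]. *)
  by rewrite -[RHS]/(coreterm x y i); have [xy|yx] := leqP x y; [|rewrite coreterm_sym;
    apply: eq_bigr => j _; rewrite /gterm (mulrC (cz x i j))].
rewrite /kernelK big_mkord mulr_sumr; apply: eq_bigr => -[j jm] _ /=.
rewrite (cvg_lim _ (inner_series (x := x) (y := y) _)) //.
by rewrite mulVKf // qHahn_neq0.
Qed.

Let qp_ge0 a n : a < 1 -> 0 <= qp a n.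
Proof. by move=> a_lt1; rewrite ltW // qpoch_gt0. Qed.

Lemma rho_ge0 i j : 0 <= rho i j.
Proof.
rewrite /rho -mulrN; apply: mulr_ge0; last by rewrite divr_ge0 // qp_ge0.
apply: mulr_ge0; first by rewrite divr_ge0 ?divr_ge0 ?qp_ge0 // exprn_ge0 // ltW.
rewrite divr_ge0 ?qp_ge0 // mulr_ge0 //; last by rewrite exprn_ge0 // ltW.
by rewrite exprn_ge0 // mulr_ge0 ?oppr_ge0 // ltW.
Qed.

Lemma core_ge0 x y : 0 <= core x y.
Proof.
apply: limr_ge; first exact: (cvg_core (a1 := a1) hq hb1 ha2 hd (x := x) (y := y)).
have wt0 a m n : a < 1 -> 0 <= wt q a m n.
  by move=> a1'; rewrite /wt; case: leqP => // _; rewrite divr_ge0 // ltW // qpoch_gt0.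
near=> N; apply: sumr_ge0 => i _; apply: sumr_ge0 => j _.
by rewrite mulr_ge0 ?rho_ge0 // mulr_ge0 // mulr_ge0 // wt0.
Unshelve. all: by end_near. Qed.

Lemma kernelK_ge0 x y : 0 <= K x y.
Proof.
rewrite kernelKE mulr_ge0 ?core_ge0 //.
have bx m : 0 <= b1 ^- m by rewrite invr_ge0 exprn_ge0 // ltW.
have k0 : 0 <= C0 / mw y by rewrite ltW // divr_gt0 // mweight_gt0.
exact: (mulr_ge0 (mulr_ge0 k0 (bx x)) (bx y)).
Qed.

Lemma kernelK_balance x y : K x y * mw y = K y x * mw x.
Proof.
rewrite !kernelKE (core_sym q a1 b1 a2 d y x); have hx := mw_neq0 x; have hy := mw_neq0 y.
by field; rewrite hx hy !expf_neq0.
Qed.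

(** C0 is the inverse of the constant produced by the 1phi1 sum, and the argument (c / d) q^(n+1) of
    the polynomial meets the factor d / q of the moments, which leaves c q^n. *)
Lemma mpoly_value n :
  C0 * limn (series (fun y => core 0%N y * (b1 ^- y * mpoly q c d n y))) = kappa q a1 b1 a2 n.
Proof.
have h k := cvg_seriesZ (c := mpolycoef q c d n k) (phi_moment a1 (k := k) hq hb1 ha2 hd).
have := cvg_series_sum (s := index_enum 'I_n.+1) (fun k : 'I_n.+1 => h k).
move=> /(@eq_cvg_series _ _ (fun y => core 0%N y * (b1 ^- y * mpoly q c d n y))) hs.
rewrite (cvg_lim _ (hs _)) //; last first.
  by move=> y; rewrite /mpoly !mulr_sumr; apply: eq_bigr => k _; ring.
rewrite /kappa big_mkord mulr_sumr; apply: eq_bigr => -[k kn] _ /=.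
have -> : (c * q ^+ n) ^+ k = (c / d * q ^+ n.+1) ^+ k * (d / q) ^+ k.
  by rewrite -exprMn exprS; congr (_ ^+ _); field; rewrite d_neq0 q_neq0.
have i1 : qi d != 0 by apply: qpoch_inf_neq0.
have i2 : qi (a2 * d) != 0 by apply: qpoch_inf_neq0.
rewrite /mpolycoef /C0; move: ((_ * _) ^+ k) ((_ / _) ^+ k) => Z Z'.
by field; rewrite i1 i2 qf_neq0 cn b1a2n.
Qed.

Lemma mratio_value n :
  C0 * limn (series (fun y => core 0%N y * (b1 ^- y * (mratio q c d y * mpoly q d c n y)))) =
  kappa_minus q a1 b1 a2 b2 n.
Proof.
have h k := cvg_seriesZ (c := mpolycoef q d c n k) (mratio_moment (k := k) hq ha1 hb1 ha2 hd).
have := cvg_series_sum (s := index_enum 'I_n.+1) (fun k : 'I_n.+1 => h k).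
move=> /(@eq_cvg_series _ _ (fun y => core 0%N y * (b1 ^- y * (mratio q c d y * mpoly q d c n y)))) hs.
rewrite (cvg_lim _ (hs _)) //; last first.
  by move=> y; rewrite /mpoly !mulr_sumr; apply: eq_bigr => k _; ring.
rewrite /kappa_minus big_mkord !mulr_sumr Nb2 Vb2 mulNr !opprK; apply: eq_bigr => -[k kn] _ /=.
have -> : SSum q a1 b1 a2 b2 k = limn (series (sterm q a1 b1 a2 d k)).
  congr (limn _); apply/funext => N; rewrite /series /=; apply: eq_bigr => j _.
  by rewrite /STerm /sterm Vb2 mulNr opprK -mulNr Nb2.
have -> : (d * q ^+ n) ^+ k = (d / c * q ^+ n.+1) ^+ k * (c / q) ^+ k.
  by rewrite -exprMn exprS; congr (_ ^+ _); field; rewrite q_neq0 b1_neq0 a1_neq0.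
have i1 : qi d != 0 by apply: qpoch_inf_neq0.
have i2 : qi (b1 * a2) != 0 by apply: qpoch_inf_neq0.
rewrite /mpolycoef /C0; move: ((d / c * _) ^+ k) ((c / q) ^+ k) => Z Z'.
by field; rewrite i1 i2 qf_neq0 cn a2dn dn.
Qed.

Lemma STerm_is_cvg k : cvgn (series (STerm q a1 b1 a2 b2 k)).
Proof.
have -> : STerm q a1 b1 a2 b2 k = sterm q a1 b1 a2 d k.
  by apply/funext => j; rewrite /STerm /sterm Vb2 mulNr opprK -mulNr Nb2.
exact: sterm_cvg.
Qed.

Lemma qMeixner_polyE n x :
  qMeixner_poly q n x (c * q^-1) ((c * a2)^-1 * b2) = mpoly q c d n x.
Proof.
rewrite /qMeixner_poly big_mkord; apply: eq_bigr => -[k kn] _ /=; rewrite /mpolycoef divfK //.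
have -> : - (((c * a2)^-1 * b2)^-1 * q ^+ n.+1) = c / d * q ^+ n.+1.
  by rewrite b2E; field; rewrite d_neq0 a1_neq0 b1_neq0 a2_neq0.
by ring.
Qed.

Lemma qMeixner_poly_dualE n x :
  qMeixner_poly q n x (- (a2^-1 * b2 * q^-1)) (c * a2 * b2^-1) = mpoly q d c n x.
Proof.
rewrite /qMeixner_poly big_mkord; apply: eq_bigr => -[k kn] _ /=; rewrite /mpolycoef.
have -> : - (a2^-1 * b2 * q^-1) * q = d by rewrite Vb2; field.
have -> : - ((c * a2 * b2^-1)^-1 * q ^+ n.+1) = d / c * q ^+ n.+1.
  by rewrite b2E; field; rewrite d_neq0 a1_neq0 b1_neq0 a2_neq0.
by ring.
Qed.

Lemma qMeixnerE x :
  qMeixner q x (c * q^-1) ((c * a2)^-1 * b2) = qi d / qi (d / c) * mw x.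
Proof.
have e : (c * a2)^-1 * b2 = - (d / c) by rewrite b2E; field; rewrite a1_neq0 b1_neq0 a2_neq0.
rewrite /qMeixner e opprK divfK // (_ : - (c * q^-1 * - (d / c) * q) = d); last first.
  by field; rewrite q_neq0 a1_neq0 b1_neq0.
by rewrite /mweight; ring.
Qed.

(** The bases - (d / c) of [mweight] and c / d of [mratio] multiply to -1, the origin of the sign
    (-1)^x in v_n. *)
Lemma vMinusE n x : vMinus q a1 b1 a2 b2 n x = mw x * (mratio q c d x * mpoly q d c n x).
Proof.
rewrite /vMinus qMeixner_poly_dualE mulrA; congr (_ * _).
rewrite /mweight /mratio.
transitivity (q ^+ 'C(x, 2) / qp q x * ((- (d / c)) ^+ x * (c / d) ^+ x)); last first.
  by field; rewrite cn dn qf_neq0.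
rewrite -exprMn (_ : - (d / c) * (c / d) = -1); first by ring.
by field; rewrite d_neq0 a1_neq0 b1_neq0.
Qed.

Let core_eigen_mpoly n x :
  series (fun y => core x y * (b1 ^- y * mpoly q c d n y)) @ \oo -->
  kappa q a1 b1 a2 n / C0 * (mw x * b1 ^+ x * mpoly q c d n x).
Proof.
have [s s0 hs] := mpoly_exp_bounded q c d n.
have := core_eigen hq ha1 hb1 ha2 hd s0 hs (mpoly_0 _ _ hq n)
  (mpoly_meixner hq c_lt1 c_neq0 d_neq0 n) (x := x).
by rewrite -mpoly_value [C0 * _]mulrC mulfK // gt_eqF.
Qed.

Let core_eigen_mratio n x :
  series (fun y => core x y * (b1 ^- y * (mratio q c d y * mpoly q d c n y))) @ \oo -->
  kappa_minus q a1 b1 a2 b2 n / C0 * (mw x * b1 ^+ x * (mratio q c d x * mpoly q d c n x)).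
Proof.
have [s s0 hs] := exp_boundedM (mratio_exp_bounded d hq c_lt1) (mpoly_exp_bounded q d c n).
have f0 : mratio q c d 0 * mpoly q d c n 0 = 1.
  by rewrite mpoly_0 // /mratio !qpoch0 expr0 divr1 !mulr1.
have := core_eigen hq ha1 hb1 ha2 hd s0 hs f0
  (mratio_meixner hq c_lt1 c_neq0 d_lt1 d_neq0 (mpoly_meixner hq d_lt1 d_neq0 c_neq0 n)) (x := x).
by rewrite -mratio_value [C0 * _]mulrC mulfK // gt_eqF.
Qed.

Let C0_neq0 : C0 != 0. Proof. by rewrite gt_eqF. Qed.

(** The eigenvalue relation sums over the second argument of [core]; symmetry turns it into the
    column sum of K. *)
Lemma kernelK_stochastic y : series (fun x => K x y) @ \oo --> (1 : R).
Proof.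
have m1 x : mpoly q c d 0 x = 1.
  by rewrite /mpoly big_ord_recl big_ord0 /mpolycoef /= !qpoch0 expr0 !mulr1 divr1 addr0.
have k1 : kappa q a1 b1 a2 0 = 1.
  by rewrite /kappa big_nat1 !qpoch0 !expr0 !mulr1 divr1.
have := cvg_seriesZ (c := C0 / mw y * b1 ^- y) (core_eigen_mpoly (n := 0%N) (x := y)).
rewrite k1 m1 (_ : C0 / _ * _ * _ = 1); last first.
  by have h := mw_neq0 y; field; rewrite h C0_neq0 expf_neq0.
apply: eq_cvg_series => x; rewrite m1 kernelKE (core_sym q a1 b1 a2 d x y); ring.
Qed.

Lemma kernelK_eigen n x :
  series (fun y => K x y * mw y * mpoly q c d n y) @ \oo -->
  kappa q a1 b1 a2 n * mw x * mpoly q c d n x.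
Proof.
have := cvg_seriesZ (c := C0 * b1 ^- x) (core_eigen_mpoly (n := n) (x := x)).
rewrite (_ : C0 * _ * _ = kappa q a1 b1 a2 n * mw x * mpoly q c d n x); last first.
  by field; rewrite C0_neq0 expf_neq0.
apply: eq_cvg_series => y; rewrite kernelKE.
by have h := mw_neq0 y; field; rewrite h !expf_neq0.
Qed.

Lemma kernelK_eigen_minus n x :
  series (fun y => K x y * vMinus q a1 b1 a2 b2 n y) @ \oo -->
  kappa_minus q a1 b1 a2 b2 n * vMinus q a1 b1 a2 b2 n x.
Proof.
have := cvg_seriesZ (c := C0 * b1 ^- x) (core_eigen_mratio (n := n) (x := x)).
rewrite (_ : C0 * _ * _ = kappa_minus q a1 b1 a2 b2 n * vMinus q a1 b1 a2 b2 n x); last first.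
  by rewrite vMinusE; field; rewrite C0_neq0 expf_neq0.
apply: eq_cvg_series => y; rewrite kernelKE vMinusE.
by have h := mw_neq0 y; field; rewrite h !expf_neq0.
Qed.
End Assembly.

Theorem mainTheorem11 (R : realType) (q a1 b1 a2 b2 : R)
    (hq : 0 < q < 1) (ha1 : 0 < a1 < 1) (hb1 : 0 < b1 < 1)
    (ha2 : 0 < a2 < 1) (hb2 : 0 < b2) :
  let K := kernelK q a1 b1 a2 b2 in
  let w := fun x : nat =>
    qMeixner q x (a1 * b1 * q^-1) ((a1 * b1 * a2)^-1 * b2) in
  let P := fun n x : nat =>
    qMeixner_poly q n x (a1 * b1 * q^-1) ((a1 * b1 * a2)^-1 * b2) in
  let v := vMinus q a1 b1 a2 b2 in
  (* the series defining K converge *)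
  (forall x y z2 : nat, (z2 <= minn x y)%N ->
     cvgn (fun N : nat =>
       \sum_(maxn x y <= z1 < N) innerTerm q b1 a2 b2 x y z2 z1)) /\
  (forall x y : nat, 0 <= K x y) /\
  (forall y : nat, series (fun x => K x y) @ \oo --> (1 : R)) /\
  (forall x y : nat, K x y * w y = K y x * w x) /\
  (forall x n : nat,
     series (fun y => K x y * w y * P n y) @ \oo -->
       kappa q a1 b1 a2 n * w x * P n x) /\
  (* the series S_k converge *)
  (forall k : nat, cvgn (series (STerm q a1 b1 a2 b2 k))) /\
  (forall n x : nat,
     series (fun y => K x y * v n y) @ \oo -->
       kappa_minus q a1 b1 a2 b2 n * v n x).
Proof.
move=> K w P v.
pose d := - (a2^-1 * b2).
have a2_gt0 : 0 < a2 by case/andP: ha2.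
have hd : d < 0 by rewrite oppr_lt0 mulr_gt0 // invr_gt0.
have b2E : b2 = - (a2 * d) by rewrite mulrN opprK mulVKf // gt_eqF.
have wE x : w x = qpoch_inf q d / qpoch_inf q (d / (a1 * b1)) * mweight q (a1 * b1) d x.
  exact: qMeixnerE.
have PE n x : P n x = mpoly q (a1 * b1) d n x by apply: qMeixner_polyE.
split=> [x y j|]; first by move=> jm; apply: (inner_is_cvg hq ha1 hb1 ha2 hd b2E).
split=> [x y|]; first exact: (kernelK_ge0 hq ha1 hb1 ha2 hd b2E).
split=> [y|]; first exact: (kernelK_stochastic hq ha1 hb1 ha2 hd b2E).
split=> [x y|].
  rewrite !wE [LHS]mulrCA [RHS]mulrCA; congr (_ * _).
  exact: (kernelK_balance hq ha1 hb1 ha2 hd b2E).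
split=> [x n|].
  have := cvg_seriesZ (c := qpoch_inf q d / qpoch_inf q (d / (a1 * b1)))
    (kernelK_eigen hq ha1 hb1 ha2 hd b2E (n := n) (x := x)).
  rewrite (_ : _ * (_ * _ * _) = kappa q a1 b1 a2 n * w x * P n x); last by rewrite wE PE; ring.
  by apply: eq_cvg_series => y; rewrite wE PE -/K; ring.
split=> [k|]; first exact: (STerm_is_cvg hq ha1 hb1 ha2 hd b2E).
by move=> n x; apply: (kernelK_eigen_minus hq ha1 hb1 ha2 hd b2E).
Qed.
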